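(* Let $\bm\sigma_{sa}\in\mathbb{R}^S$ with $\bm\sigma_{sa}>\bm 0$ component-wise, $\bm\Sigma_{sa}=\mathrm{diag}(\bm\sigma_{sa})$, $\overline{\bm p}_{sa}\in\Delta_S$, $\bm b\in\mathbb{R}^S_+$ and $\beta\in\mathbb{R}_+$ with $\min_i b_i\le\beta$. For the deviation measure $d_a(\bm p_{sa},\overline{\bm p}_{sa})=\lVert\bm\Sigma_{sa}(\bm p_{sa}-\overline{\bm p}_{sa})\rVert_1$, the projection problem $$\mathfrak{P}(\overline{\bm p}_{sa};\bm b,\beta)=\min\{d_a(\bm p_{sa},\overline{\bm p}_{sa}):\ \bm b^\top\bm p_{sa}\le\beta,\ \bm p_{sa}\in\Delta_S\}$$ can be solved (i.e., its optimal value can be computed exactly) in time $\mathcal{O}(S\log S)$.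
   Context: $\Delta_S=\{\bm p\in\mathbb{R}^S_+:\mathbf{e}^\top\bm p=1\}$ is the probability simplex in $\mathbb{R}^S$, with $\mathbf{e}$ the all-ones vector. Time counts elementary arithmetic operations and comparisons on real numbers. *)

(* Defs.v *)
From HB Require Import structures.
From mathcomp Require Import all_boot all_order all_algebra.
From mathcomp Require Import boolp classical_sets reals topology normedtype.
From mathcomp Require Import landau exp.

Set Implicit Arguments.
Unset Strict Implicit.
Unset Printing Implicit Defensive.

Import Order.TTheory GRing.Theory Num.Theory.
Import numFieldNormedType.Exports.

Local Open Scope classical_set_scope.
Local Open Scope ring_scope.

Section Projection.
Variable R : realType.

Definition is_minimum (A : set R) (m : R) : Prop := A m /\ lbound A m.

Definition simplex (S : nat) : set 'cV[R]_S :=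
  [set p | (forall i, 0 <= p i 0) /\ \sum_i p i 0 = 1].

Definition norm1 (S : nat) (v : 'cV[R]_S) : R := \sum_i `|v i 0|.

Record instance (S : nat) := Instance {
  sigma : 'cV[R]_S;
  pbar : 'cV[R]_S;
  bvec : 'cV[R]_S;
  beta : R
}.

Definition valid_instance (S : nat) (I : instance S) : Prop :=
  [/\ forall i, 0 < sigma I i 0,
      simplex (pbar I),
      forall i, 0 <= bvec I i 0,
      0 <= beta I
    & exists2 bmin, is_minimum (range (fun i => bvec I i 0)) bmin
                    & bmin <= beta I].

Definition deviation (S : nat) (I : instance S) (p : 'cV[R]_S) : R :=
  norm1 (diag_mx (sigma I)^T *m (p - pbar I)).

Definition feasible (S : nat) (I : instance S) : set 'cV[R]_S :=
  [set p | ((bvec I)^T *m p) 0 0 <= beta I /\ simplex p].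

Definition is_optimal_value (S : nat) (I : instance S) (v : R) : Prop :=
  is_minimum (deviation I @` feasible I) v.

End Projection.

(* A uniform real RAM, presented as a while language.  A program is one finite
   piece of syntax, independent of the dimension S and of the data.  It has
   integer and real variables and unbounded integer and real arrays, each named
   by a natural number.  Real numbers can only be moved, combined by + - * /,
   and compared: in particular there is no rounding or conversion from reals to
   integers.  Integers serve as indices and counters; there is no unit-cost
   integer multiplication. *)

Inductive instr :=
| NConst of nat & nat          (* x := c *)
| NMove of nat & nat           (* x := y *)
| NAdd of nat & nat & nat      (* x := y + z *)
| NSub of nat & nat & nat      (* x := y - z, truncated at 0 *)
| NHalf of nat & nat           (* x := floor (y / 2) *)
| NLoad of nat & nat & nat     (* x := a[i] *)
| NStore of nat & nat & nat    (* a[i] := x *)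
| RConst of nat & nat          (* x := c, a natural number *)
| RMove of nat & nat
| RAdd of nat & nat & nat
| RSub of nat & nat & nat
| RMul of nat & nat & nat
| RDiv of nat & nat & nat
| RLoad of nat & nat & nat     (* x := a[i], i an integer variable *)
| RStore of nat & nat & nat.   (* a[i] := x, i an integer variable *)

Inductive test :=
| NLe of nat & nat             (* x <= y on integer variables *)
| RLe of nat & nat.            (* x <= y on real variables *)

Inductive prog :=
| Skip
| Do of instr
| Seq of prog & prog
| If of test & prog & prog
| While of test & prog.

Section Semantics.
Variable R : realType.

Record state := State {
  nvar : nat -> nat;
  narr : nat -> nat -> nat;
  rvar : nat -> R;
  rarr : nat -> nat -> R
}.

Definition upd (A : Type) (f : nat -> A) (x : nat) (v : A) : nat -> A :=
  fun y => if y == x then v else f y.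

Definition set_nvar (s : state) x v :=
  State (upd (nvar s) x v) (narr s) (rvar s) (rarr s).
Definition set_narr (s : state) a i v :=
  State (nvar s) (upd (narr s) a (upd (narr s a) i v)) (rvar s) (rarr s).
Definition set_rvar (s : state) x v :=
  State (nvar s) (narr s) (upd (rvar s) x v) (rarr s).
Definition set_rarr (s : state) a i v :=
  State (nvar s) (narr s) (rvar s) (upd (rarr s) a (upd (rarr s a) i v)).

(* Division by zero returns 0, which adds no power: a program can obtain the
   same effect by testing the divisor first. *)
Definition step (c : instr) (s : state) : state :=
  match c with
  | NConst x k => set_nvar s x k
  | NMove x y => set_nvar s x (nvar s y)
  | NAdd x y z => set_nvar s x (nvar s y + nvar s z)%N
  | NSub x y z => set_nvar s x (nvar s y - nvar s z)%N
  | NHalf x y => set_nvar s x (nvar s y)./2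
  | NLoad x a i => set_nvar s x (narr s a (nvar s i))
  | NStore a i x => set_narr s a (nvar s i) (nvar s x)
  | RConst x k => set_rvar s x k%:R
  | RMove x y => set_rvar s x (rvar s y)
  | RAdd x y z => set_rvar s x (rvar s y + rvar s z)
  | RSub x y z => set_rvar s x (rvar s y - rvar s z)
  | RMul x y z => set_rvar s x (rvar s y * rvar s z)
  | RDiv x y z =>
      set_rvar s x (if rvar s z == 0 then 0 else rvar s y / rvar s z)
  | RLoad x a i => set_rvar s x (rarr s a (nvar s i))
  | RStore a i x => set_rarr s a (nvar s i) (rvar s x)
  end.

Definition holds (t : test) (s : state) : bool :=
  match t with
  | NLe x y => (nvar s x <= nvar s y)%N
  | RLe x y => rvar s x <= rvar s y
  end.

(* [exec P s k s'] : started in s, P halts in s' after k time units.  Every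
   instruction and every evaluation of a test costs one unit, so k bounds the
   number of arithmetic operations and comparisons on reals, and also accounts
   for all data movement and index manipulation. *)
Inductive exec : prog -> state -> nat -> state -> Prop :=
| ExecSkip s : exec Skip s 0 s
| ExecDo c s : exec (Do c) s 1 (step c s)
| ExecSeq P Q s k s' l s'' :
    exec P s k s' -> exec Q s' l s'' -> exec (Seq P Q) s (k + l) s''
| ExecIfTrue t P Q s k s' :
    holds t s -> exec P s k s' -> exec (If t P Q) s k.+1 s'
| ExecIfFalse t P Q s k s' :
    ~~ holds t s -> exec Q s k s' -> exec (If t P Q) s k.+1 s'
| ExecWhileTrue t P s k s' l s'' :
    holds t s -> exec P s k s' -> exec (While t P) s' l s'' ->
    exec (While t P) s (k + l).+1 s''
| ExecWhileFalse t P s : ~~ holds t s -> exec (While t P) s 1 s.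

Lemma exec_det P s k s' l s'' :
  exec P s k s' -> exec P s l s'' -> k = l /\ s' = s''.
Proof.
move=> e; elim: e l s'' => {P s k s'};
  intros; match goal with e : exec _ _ _ _ |- _ => inversion e; subst end;
  try match goal with
    H1 : is_true ?b, H2 : is_true (~~ ?b) |- _ => by rewrite H1 in H2
  end;
  repeat match goal with
    IH : (forall l s'', exec ?P ?s l s'' -> _), H : exec ?P ?s _ _ |- _ =>
      case: (IH _ _ H) => ? ?; subst; clear H
  end; by split.
Qed.

Definition entry (S : nat) (v : 'cV[R]_S) (j : nat) : R :=
  if insub j is Some i then v i 0 else 0.

(* Integer variable 0 holds S, real arrays 0, 1, 2 hold sigma, pbar and b, and
   real variable 0 holds beta; everything else is 0. *)
Definition init_state (S : nat) (I : instance R S) : state :=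
  State (upd (fun=> 0%N) 0 S)
        (fun _ _ => 0%N)
        (upd (fun=> 0) 0 (beta I))
        (upd (upd (upd (fun _ _ => 0) 0 (entry (sigma I)))
                  1 (entry (pbar I)))
             2 (entry (bvec I))).

(* The answer is read off real variable 0 upon halting. *)
Definition computes_optimal_value_in (P : prog) (T : nat -> nat) : Prop :=
  forall (S : nat) (I : instance R S), valid_instance I ->
    exists k s', [/\ exec P (init_state I) k s',
                     (k <= T S)%N
                   & is_optimal_value I (rvar s' 0)].

End Semantics.

(* Main.v *)
Require Import Defs.
From mathcomp Require Import all_boot all_order all_algebra.
From mathcomp Require Import boolp classical_sets reals topology normedtype.
From mathcomp Require Import landau exp.
From mathcomp Require Import ring lra zify.
Import numFieldNormedType.Exports.
Local Open Scope classical_set_scope.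
Local Open Scope ring_scope.

Set Implicit Arguments.
Unset Strict Implicit.
Unset Printing Implicit Defensive.

Import Order.TTheory GRing.Theory Num.Theory.

(** The constraint set couples the coordinates only through the two linear
    forms [sum p] and [b^T p].  Pricing [b] at a rate [y >= 0] turns the problem
    into an unconstrained transport problem: every unit of mass sitting at [i]
    either stays, at cost [y b_i], or is moved to the cheapest destination, at
    cost [sigma_i + m(y)] where [m(y) = min_j (sigma_j + y b_j)].  The resulting
    Lagrangian dual
<<
      g(y) = - y beta + sum_i pbar_i min (y b_i, sigma_i + m(y))
>>
    is concave and piecewise linear, it never exceeds the optimal value
    ([weak_duality]), and its maximum over [y >= 0] is attained by the primal
    ([strong_duality]): [g] is the minimum of finitely many affine functions, one
    for each map sending [i] to a destination, and two of these maps can be mixed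
    into a feasible point.  So it suffices to maximise [g].

    Evaluating [g] and a supergradient at a point takes time O(S), and the sign of
    the supergradient tells on which side a maximiser lies
    ([dual_supergradient]).  A binary search over a sorted list of S points
    therefore costs O(S log S), and after it [g] is known to be dominated by the
    best value seen everywhere except strictly between two consecutive points
    ([search_spec]).  Two such searches are enough.
    - The first one runs over the breakpoints of the concave function [m].  These
      are produced in order by sorting the lines [sigma_j + y b_j] by slope and
      sweeping them with a stack ([scan_spec]).  Afterwards [m] is a single line
      [sigma_p + y b_p] on the interval that is left.
    - On that interval the only breakpoints of [g] are the points where
      [y b_i = sigma_i + sigma_p + y b_p]; they are sorted and searched in turn.
      Every point of the interval now lies on an affine piece of [g] whose ends
      have been dominated, or on an unbounded piece, which cannot increase because
      [g] is bounded above by the optimal value ([le_between_crossings]).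

    Both sorts extract maxima from a tournament tree ([sort_keys_spec]), each
    extraction costing O(log S).  The programs are verified in a logic of total
    correctness with a time budget ([wp]). *)

(** * A program logic with time budgets *)

Section ProgramLogic.
Variable R : realType.
Implicit Types (s : state R) (Q : state R -> Prop) (P : prog) (c : instr).

(** Total correctness within [k] time units.  Since [k] is only an upper bound,
    budgets can be rounded up whenever two fragments are combined. *)
Definition wp P (k : nat) Q s :=
  exists l s', [/\ exec P s l s', (l <= k)%N & Q s'].

(** The locations that a program may write are read off its syntax, so that for a
    concrete program the side conditions of [frame] are decided by computation. *)
Fixpoint has_instr (p : pred instr) P : bool :=
  match P with
  | Skip => false
  | Do c => p c
  | Seq P1 P2 | If _ P1 P2 => has_instr p P1 || has_instr p P2
  | While _ P1 => has_instr p P1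
  end.

Definition sets_nvar x c :=
  match c with
  | NConst y _ | NMove y _ | NAdd y _ _ | NSub y _ _ | NHalf y _
  | NLoad y _ _ => x == y
  | _ => false
  end.

Definition sets_narr a c := if c is NStore a' _ _ then a == a' else false.

Definition sets_rvar x c :=
  match c with
  | RConst y _ | RMove y _ | RAdd y _ _ | RSub y _ _ | RMul y _ _
  | RDiv y _ _ | RLoad y _ _ => x == y
  | _ => false
  end.

Definition sets_rarr a c := if c is RStore a' _ _ then a == a' else false.

Record frame P s s' : Prop := Frame {
  frame_nvar : forall x, ~~ has_instr (sets_nvar x) P -> nvar s' x = nvar s x;
  frame_narr : forall a, ~~ has_instr (sets_narr a) P -> narr s' a = narr s a;
  frame_rvar : forall x, ~~ has_instr (sets_rvar x) P -> rvar s' x = rvar s x;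
  frame_rarr : forall a, ~~ has_instr (sets_rarr a) P -> rarr s' a = rarr s a
}.

Lemma frame_refl P s : frame P s s.
Proof. by split. Qed.

Lemma frame_trans P s s' s'' : frame P s s' -> frame P s' s'' -> frame P s s''.
Proof.
by case=> a b c d [a' b' c' d']; split=> x nx;
   rewrite ?(a', b', c', d') ?(a, b, c, d).
Qed.

Lemma sub_frame P P' s s' :
  (forall p, has_instr p P' -> has_instr p P) -> frame P' s s' -> frame P s s'.
Proof.
by move=> sub [a b c d]; split=> x nx; rewrite ?(a, b, c, d) //;
   apply: contra nx; apply: sub.
Qed.

Lemma exec_frame P s k s' : exec P s k s' -> frame P s s'.
Proof.
elim=> {P s k s'} /=.
- by move=> s; apply: frame_refl.
- move=> [x n|x y|x y z|x y z|x y|x a i|a i x|x n|x y|x y z|x y z|x y z|x y z|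
          x a i|a i x] s; split=> //= u nu; by rewrite /upd (negPf nu).
- move=> P P' s k s' l s'' _ f1 _ f2; apply: (@frame_trans _ _ s').
    by apply: sub_frame f1 => p /= ->.
  by apply: sub_frame f2 => p /= ->; rewrite orbT.
- by move=> t P P' s k s' _ _; apply: sub_frame => p /= ->.
- by move=> t P P' s k s' _ _; apply: sub_frame => p /= ->; rewrite orbT.
- move=> t P s k s' l s'' _ _ f1 _ f2; apply: (@frame_trans _ _ s') f2.
  exact: sub_frame f1.
- by move=> t P s _; apply: frame_refl.
Qed.

Lemma wp_do c k Q s : Q (step c s) -> wp (Do c) k.+1 Q s.
Proof. by move=> q; exists 1%N, (step c s); split=> //; apply: ExecDo. Qed.

Lemma wp_skip k Q s : Q s -> wp Skip k Q s.
Proof. by move=> q; exists 0%N, s; split=> //; apply: ExecSkip. Qed.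

Lemma wp_seq P1 P2 k1 k2 Q s :
  wp P1 k1 (wp P2 k2 Q) s -> wp (Seq P1 P2) (k1 + k2) Q s.
Proof.
move=> [l [s' [e1 le1 [l' [s'' [e2 le2 q]]]]]].
by exists (l + l')%N, s''; split=> //; [apply: ExecSeq e1 e2|apply: leq_add].
Qed.

Lemma wp_step c P k Q s : wp P k Q (step c s) -> wp (Seq (Do c) P) k.+1 Q s.
Proof. by move=> h; apply: (@wp_seq _ _ 1); apply: wp_do. Qed.

Lemma wp_if t P1 P2 k Q s :
  (holds t s -> wp P1 k Q s) -> (~~ holds t s -> wp P2 k Q s) ->
  wp (If t P1 P2) k.+1 Q s.
Proof.
case h: (holds t s) => hT hF.
  have [l [s' [e le q]]] := hT isT.
  by exists l.+1, s'; split=> //; apply: ExecIfTrue.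
have [l [s' [e le q]]] := hF isT.
by exists l.+1, s'; split=> //; apply: ExecIfFalse; rewrite ?h.
Qed.

(** The continuation receives the frame of [P] for free; this is why the
    specifications below only speak about the locations that a fragment changes. *)
Lemma wp_call P k k' Q Q' s :
  wp P k Q s -> (k <= k')%N -> (forall s', frame P s s' -> Q s' -> Q' s') ->
  wp P k' Q' s.
Proof.
move=> [l [s' [e le q]]] lek h; exists l, s'; split=> //.
  exact: leq_trans lek.
by apply: h => //; apply: exec_frame e.
Qed.

(** The measure [m] bounds the number of iterations left.  It may drop by more than
    one at a time, which is what amortised arguments need. *)
Lemma wp_while t P (c : nat) (Inv : nat -> state R -> Prop) m s0 :
  Inv m s0 ->
  (forall m s, frame P s0 s -> Inv m s -> holds t s ->
     wp P c (fun s' => exists2 m', (m' < m)%N & Inv m' s') s) ->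
  wp (While t P) (m * c.+1 + 1)
    (fun s => (exists m', Inv m' s) /\ ~~ holds t s) s0.
Proof.
move=> i0 body.
have [n lemn] := ubnP m.
have := frame_refl P s0; move: {1 3 4}s0 i0.
elim: n m lemn => // n IHn m lemn s inv fr.
case h: (holds t s); last first.
  exists 1%N, s; split; [by apply: ExecWhileFalse; rewrite h| |].
    by rewrite addn1.
  by split; [exists m|rewrite h].
have [l [s' [e le [m' ltm inv']]]] := body _ _ fr inv h.
have fr' := frame_trans fr (exec_frame e).
have [l' [s'' [e' le' q]]] := IHn _ (leq_trans ltm lemn) _ inv' fr'.
exists (l + l').+1, s''; split=> //; first exact: ExecWhileTrue e e'.
apply: leq_trans (_ : (m'.+1 * c.+1 + 1 <= _)%N).
  by rewrite mulSn -addnA addSn ltnS; apply: leq_add.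
by rewrite leq_add2r leq_mul2r ltm orbT.
Qed.

(** A countdown from [n - 1] to 0.  Counting down makes the loop test a comparison
    with the constant one, kept in register [one]. *)
Definition For one i n P :=
  Seq (Do (NMove i n)) (While (NLe one i) (Seq (Do (NSub i i one)) P)).

(** [Inv j] says that the indices from [j] on have been processed.  It must not
    depend on the loop counter, which changes between two calls of the body. *)
Lemma wp_for one i n P (c : nat) (Inv : nat -> state R -> Prop) N s0 :
  nvar s0 n = N ->
  nvar s0 one = 1%N -> one != i ->
  ~~ has_instr (sets_nvar i) P -> ~~ has_instr (sets_nvar one) P ->
  (forall j v s, Inv j s -> Inv j (set_nvar s i v)) ->
  Inv N s0 ->
  (forall j s, (j < N)%N -> nvar s i = j ->
     frame (For one i n P) s0 s -> Inv j.+1 s -> wp P c (Inv j) s) ->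
  wp (For one i n P) (N * c.+2 + 2) (Inv 0%N) s0.
Proof.
move=> <- one1 onei niP noneP stable inv0 body.
rewrite addnS; apply: wp_step; rewrite [step _ _]/=.
set s1 := set_nvar _ _ _; set W := While _ _.
have fr1 : frame (For one i n P) s0 s1.
  by split=> //= x; rewrite /upd; case: eqP.
have frW s : frame W s1 s -> frame (For one i n P) s0 s.
  move=> fr; apply: frame_trans fr1 _.
  by apply: sub_frame fr => p /= ->; rewrite orbT.
apply: (@wp_call _ _ _ (fun s =>
    (exists m, [/\ nvar s i = m, (m <= nvar s0 n)%N & Inv m s]) /\
    ~~ holds (NLe one i) s)).
- apply: (@wp_while _ _ c.+1 (fun m s =>
    [/\ nvar s i = m, (m <= nvar s0 n)%N & Inv m s])) => [|m s fr].
    by split; [rewrite /= /upd eqxx| |apply: stable].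
  case=> im lem inv /=.
  have -> : nvar s one = 1%N.
    rewrite (frame_nvar fr) /= ?negb_or ?onei ?noneP //.
    by rewrite /upd (negPf onei).
  rewrite im => m0; apply: wp_step => /=.
  apply: (@wp_call _ c _ (Inv m.-1)) => //.
    apply: body => /=; first by rewrite prednK.
    + rewrite /upd eqxx im (frame_nvar fr) /= ?negb_or ?onei ?noneP //.
      by rewrite /upd (negPf onei) one1 subn1.
    + apply: (@frame_trans _ _ s); first by apply: frW; apply: sub_frame fr.
      by split=> //= x; rewrite /upd; case: eqP.
    + by rewrite prednK //; apply: stable.
  move=> s' fr' inv'; exists m.-1; first by rewrite prednK.
  split=> //; last by rewrite (leq_trans (leq_pred m)).
  rewrite (frame_nvar fr') //= /upd eqxx im.
  rewrite (frame_nvar fr) /= ?negb_or ?onei ?noneP //.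
  by rewrite /upd (negPf onei) one1 subn1.
- by [].
move=> s' fr [[m [im _ inv]]] /=.
rewrite (frame_nvar fr) /= ?negb_or ?onei ?noneP // /upd (negPf onei) one1 im.
by rewrite lt0n negbK => /eqP <-.
Qed.

End ProgramLogic.

(** * The Lagrangian dual and its breakpoints *)

Section Duality.
Variables (R : realType) (n : nat) (sg pb b : nat -> R) (beta : R).

(** The data are functions on all of [nat], as in the memory of the machine; only
    their values below [n] matter. *)
Record wf_data : Prop := WfData {
  n_gt0 : (0 < n)%N;
  sg_gt0 : forall i, (i < n)%N -> 0 < sg i;
  pb_ge0 : forall i, (i < n)%N -> 0 <= pb i;
  sum_pb : \sum_(i < n) pb i = 1;
  b_ge0 : forall i, (i < n)%N -> 0 <= b i;
  exists_b_le : exists2 i, (i < n)%N & b i <= beta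
}.

Definition line (j : nat) (y : R) := sg j + y * b j.

(** The cheapest price of a destination when [b] is charged at rate [y]. *)
Definition envelope (y : R) := \big[Num.min/line 0 y]_(i < n) line i y.

(** The Lagrangian relaxation of the constraint [b^T p <= beta]: the mass at [i]
    stays in place or goes to the cheapest destination. *)
Definition dual (y : R) :=
  - (y * beta) + \sum_(i < n) pb i * Num.min (y * b i) (sg i + envelope y).

Lemma envelope_le j y : (j < n)%N -> envelope y <= line j y.
Proof.
by move=> jn; rewrite /envelope (bigD1 (Ordinal jn)) //= ge_min lexx.
Qed.

Hypothesis wf : wf_data.

Lemma envelope_attained y : exists2 j, (j < n)%N & envelope y = line j y.
Proof.
rewrite /envelope; elim/big_ind: _ => [|u v [j jn ->] [k kn ->]|i _].
- by exists 0%N; first exact: n_gt0 wf.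
- by rewrite /Num.min; case: ifP => _; [exists j|exists k].
- by exists i.
Qed.

Lemma envelopeP j y : (j < n)%N -> (forall k, (k < n)%N -> line j y <= line k y) ->
  envelope y = line j y.
Proof.
move=> jn le; apply/le_anti; rewrite envelope_le //=.
by have [k kn ->] := envelope_attained y; apply: le.
Qed.

Lemma dual0 : dual 0 = 0.
Proof.
rewrite /dual mul0r oppr0 add0r big1 // => i _; rewrite mul0r min_l ?mulr0 //.
have [k kn ->] := envelope_attained 0.
by rewrite /line mul0r addr0 addr_ge0 ?ltW ?(sg_gt0 wf).
Qed.

(** Freezing at [x] the choice of staying or leaving, and the destination [j],
    gives an affine function of the rate which is above [dual] and touches it at
    [x]. *)
Lemma dual_supergradient j x y : (j < n)%N -> envelope x = line j x ->
  dual y <= dual x + (- beta + \sum_(i < n) pb i *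
      (if x * b i <= sg i + envelope x then b i else b j)) * (y - x).
Proof.
move=> jn ej.
have term (i : 'I_n) : pb i * Num.min (y * b i) (sg i + envelope y) <=
    pb i * Num.min (x * b i) (sg i + envelope x) +
    pb i * (if x * b i <= sg i + envelope x then b i else b j) * (y - x).
  rewrite -mulrA -mulrDr ler_wpM2l ?(pb_ge0 wf) //.
  case: (leP (x * b i)) => _.
    by rewrite ge_min; apply/orP; left; lra.
  have := envelope_le y jn; rewrite ge_min ej /line => h.
  by apply/orP; right; lra.
rewrite /dual mulrDl mulr_suml.
have := ler_sum (index_enum _) (fun i (_ : xpredT i) => term i); rewrite big_split /=.
by move=> ? ; lra.
Qed.

(** The prices [u_i = min (y b_i, sg i + m)] are at most [y b_i] and within [sg i] of
    [m], because [m <= sg i + y b_i].  Hence replacing [p] by [pb] changes the value of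
    the mass by at most the weighted distance, [m] being harmless as both have the
    same total mass. *)
Lemma weak_duality (p : 'I_n -> R) (y : R) : 0 <= y -> (forall i, 0 <= p i) ->
  \sum_i p i = 1 -> \sum_(i < n) b i * p i <= beta ->
  dual y <= \sum_(i < n) sg i * `|p i - pb i|.
Proof.
move=> y0 p0 p1 pbeta; set m := envelope y.
have term (i : 'I_n) : pb i * Num.min (y * b i) (sg i + m) <=
   sg i * `|p i - pb i| + y * (b i * p i) + m * (pb i - p i).
  set u := Num.min _ _.
  have u1 : u <= y * b i by rewrite ge_min lexx.
  have u2 : u - m <= sg i by rewrite lerBlDr ge_min lexx orbT.
  have u3 : - sg i <= u - m.
    have := envelope_le y (ltn_ord i); rewrite -/m /line => h.
    have s0 := sg_gt0 wf (ltn_ord i).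
    by rewrite lerBrDr le_min; apply/andP; split; lra.
  have pu : p i * u <= p i * (y * b i) by rewrite ler_wpM2l.
  have : (pb i - p i) * (u - m) <= sg i * `|p i - pb i|.
    rewrite (le_trans (ler_norm _)) // normrM distrC mulrC ler_wpM2r //.
    by rewrite ler_norml u2 u3.
  by move=> ?; lra.
have := ler_sum (index_enum _) (fun i (_ : xpredT i) => term i).
rewrite 2!big_split /= -!mulr_sumr sumrB p1 (sum_pb wf) subrr mulr0 addr0.
have : y * (\sum_(i < n) b i * p i) <= y * beta by rewrite ler_wpM2l.
by rewrite /dual -/m => ? ?; lra.
Qed.

(** A theorem of the alternative in the plane: if the half-planes cut out by all
    directions [(1, y)] with [y >= 0] each contain a point [(A i, B i)], then some
    segment between two of the points meets the negative quadrant. *)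
Lemma mix_two (I : finType) (A B : I -> R) :
  (forall y, 0 <= y -> exists i, A i + y * B i <= 0) ->
  exists (i j : I) (l : R), [/\ 0 <= l <= 1,
    l * A i + (1 - l) * A j <= 0 & l * B i + (1 - l) * B j <= 0].
Proof.
move=> cover.
case: (pselect (exists i, A i <= 0 /\ B i <= 0)) => [[i [Ai Bi]]|no].
  by exists i, i, 1; split; lra.
have B_gt0 i : A i <= 0 -> 0 < B i.
  by move=> Ai; case: ltP => // Bi; case: no; exists i.
have [i0 Ai0] := cover 0 (lexx 0); rewrite mul0r addr0 in Ai0.
(* A point with [B i > 0] stays in its half-plane up to the rate [th i], and the
   one that lasts longest is mixed with a point that has taken over by then. *)
pose th i := - A i / B i.
have [i Ai imax] := @Order.TotalTheory.arg_maxP _ _ _ i0 (fun i => A i <= 0) th Ai0.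
have Bi := B_gt0 _ Ai.
have thi : 0 <= th i by rewrite /th divr_ge0 ?oppr_ge0 // ltW.
case: (pselect (exists j, B j < 0 /\ A j + th i * B j <= 0)) => [[j [Bj Aj]]|none].
  have d : 0 < B i - B j by lra.
  exists i, j, (- B j / (B i - B j)); split.
  - by apply/andP; split; rewrite ?ler_pdivlMr ?ler_pdivrMr; lra.
  - have -> : - B j / (B i - B j) * A i + (1 - - B j / (B i - B j)) * A j =
      B i / (B i - B j) * (A j + th i * B j).
      by rewrite /th; field; rewrite !gt_eqF.
    by apply: mulr_ge0_le0 => //; rewrite divr_ge0 // ltW.
  - suff -> : - B j / (B i - B j) * B i + (1 - - B j / (B i - B j)) * B j = 0 by [].
    by field; rewrite gt_eqF.
(* If no point had taken over at the rate [th i], none would have done so slightly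
   later either, contradicting the assumption. *)
pose e j := if B j < 0 then - (A j + th i * B j) / (2 * B j) else 1.
have e_gt0 j : 0 < e j.
  rewrite /e; case: ifP => // Bj; have : 0 < A j + th i * B j.
    by case: ltP => // Aj; case: none; exists j.
  by move=> Aj; rewrite mulNr -mulrN -invrN mulr_gt0 ?invr_gt0; lra.
pose em := \big[Num.min/1]_j e j.
have em_gt0 : 0 < em by rewrite /em; elim/big_ind: _ => // u v; rewrite lt_min => -> ->.
have em_le j : em <= e j by rewrite /em (bigD1 j) //= ge_min lexx.
have [|j] := cover (th i + em); first by lra.
have := em_le j; rewrite /e; case: ltP => Bj.
  move=> emj.
  have : 0 < A j + th i * B j by case: ltP => // Aj; case: none; exists j.
  have : - (em * B j) * 2 <= A j + th i * B j.
    move: emj; rewrite ler_ndivlMr; last by lra.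
    by lra.
  by lra.
move=> _; case: (leP (A j) 0) => Aj.
  have : th j <= th i := imax _ Aj.
  rewrite {1}/th ler_pdivrMr ?B_gt0 // => h.
  have : 0 < em * B j by rewrite mulr_gt0 ?B_gt0.
  by lra.
have : 0 <= (th i + em) * B j by rewrite mulr_ge0 //; lra.
by lra.
Qed.

(** A map [f] moves all the mass of [i] to [f i].  It costs [A f] and leads to the
    value [B f] of [b^T p], and for every rate [y] the best response is such a map;
    so [mix_two] yields two maps whose mixture is feasible and cheap. *)
Lemma strong_duality (v : R) : (forall y, 0 <= y -> dual y <= v) ->
  exists p : 'I_n -> R, [/\ forall i, 0 <= p i, \sum_i p i = 1,
    \sum_(i < n) b i * p i <= beta & \sum_(i < n) sg i * `|p i - pb i| <= v].
Proof.
move=> bound.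
pose cost (i j : 'I_n) := if i == j then 0 else sg i + sg j.
pose A (f : {ffun 'I_n -> 'I_n}) := \sum_(i < n) pb i * cost i (f i).
pose B (f : {ffun 'I_n -> 'I_n}) := \sum_(i < n) pb i * b (f i).
have cover y : 0 <= y -> exists f, A f - v + y * (B f - beta) <= 0.
  move=> y0; have [j jn ej] := envelope_attained y.
  exists [ffun i : 'I_n =>
    if y * b i <= sg i + envelope y then i else Ordinal jn].
  have := bound y y0; rewrite /dual /A /B => h.
  set f := finfun _; set T := \sum_i _ in h.
  suff : \sum_(i < n) pb i * cost i (f i) + y * \sum_(i < n) pb i * b (f i) <= T.
    by lra.
  rewrite mulr_sumr -big_split /=.
  apply: ler_sum => i _; rewrite ffunE mulrCA -mulrDr ler_wpM2l ?(pb_ge0 wf) //.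
  case: (leP (y * b i)) => le; first by rewrite /cost eqxx add0r.
  rewrite /cost ej /line; case: eqP => [e|_]; last by rewrite /=; lra.
  by have := sg_gt0 wf (ltn_ord i); have := sg_gt0 wf jn; rewrite {1 2}e /=; lra.
have [f [f' [l [/andP[l0 l1] hA hB]]]] := mix_two cover.
pose move_mass (f : {ffun 'I_n -> 'I_n}) j := \sum_(i | f i == j) pb i.
have mm0 f0 j : 0 <= move_mass f0 j by apply: sumr_ge0 => i _; apply: (pb_ge0 wf).
have mm_sum f0 (h : nat -> R) :
    \sum_(j < n) h j * move_mass f0 j = \sum_(i < n) pb i * h (f0 i).
  rewrite [RHS](partition_big f0 xpredT) //=; apply: eq_bigr => j _.
  by rewrite mulr_sumr; apply: eq_bigr => i /eqP ->; rewrite mulrC.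
have mm_dev f0 : \sum_(j < n) sg j * `|move_mass f0 j - pb j| <= A f0.
  have split_mass j : move_mass f0 j - pb j =
      \sum_(i < n) pb i * ((f0 i == j)%:R - (i == j)%:R).
    under eq_bigr do rewrite mulrBr; rewrite sumrB /move_mass big_mkcond /=.
    congr (_ - _); first by apply: eq_bigr => i _; case: eqP; rewrite ?mulr1 ?mulr0.
    rewrite (bigD1 j) //= eqxx mulr1 big1 ?addr0 // => i /negPf ->.
    by rewrite mulr0.
  apply: (@le_trans _ _ (\sum_(j < n) \sum_(i < n)
      pb i * (sg j * `|(f0 i == j)%:R - (i == j)%:R|))).
    apply: ler_sum => j _; rewrite split_mass.
    under [leRHS]eq_bigr do rewrite mulrCA; rewrite -mulr_sumr ler_wpM2l //.
      by rewrite ltW ?(sg_gt0 wf).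
    rewrite (le_trans (ler_norm_sum _ _ _)) //; apply: ler_sum => i _.
    by rewrite normrM ger0_norm ?(pb_ge0 wf).
  rewrite exchange_big; apply: ler_sum => i _; rewrite -mulr_sumr.
  rewrite ler_wpM2l ?(pb_ge0 wf) // /cost; case: eqP => [<-|/eqP ne].
    by rewrite big1 // => j _; rewrite subrr normr0 mulr0.
  rewrite (bigD1 i) //= (bigD1 (f0 i)) 1?eq_sym //= big1 => [|j /andP[ji jf]].
    by rewrite !eqxx (negPf ne) sub0r subr0 normrN !normr1 !mulr1 addr0.
  by rewrite !(eq_sym _ j) (negPf jf) (negPf ji) subrr normr0 mulr0.
exists (fun j => l * move_mass f j + (1 - l) * move_mass f' j); split.
- by move=> j; rewrite addr_ge0 ?mulr_ge0 //; lra.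
- rewrite big_split /= -!mulr_sumr.
  have one f0 : \sum_j move_mass f0 j = 1.
    rewrite -(sum_pb wf) -[LHS]/(\sum_(j < n) move_mass f0 j).
    under eq_bigr do rewrite -[move_mass _ _]mul1r.
    by rewrite (mm_sum f0 (fun=> 1)); under eq_bigr do rewrite mulr1.
  by rewrite !one; lra.
- under eq_bigr do rewrite mulrDr !(mulrCA (b _)).
  by rewrite big_split /= -!mulr_sumr !mm_sum -/(B f) -/(B f'); lra.
- apply: (@le_trans _ _ (l * A f + (1 - l) * A f')); last by lra.
  apply: (@le_trans _ _ (\sum_(j < n)
     (l * (sg j * `|move_mass f j - pb j|) +
      (1 - l) * (sg j * `|move_mass f' j - pb j|)))).
    apply: ler_sum => j _; rewrite !(mulrCA _ (sg j)) -mulrDr ler_wpM2l //.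
      by rewrite ltW ?(sg_gt0 wf).
    have -> : l * move_mass f j + (1 - l) * move_mass f' j - pb j =
      l * (move_mass f j - pb j) + (1 - l) * (move_mass f' j - pb j) by ring.
    rewrite (le_trans (ler_normD _ _)) // !normrM !(@ger0_norm _ l) //.
    by rewrite (@ger0_norm _ (1 - l)) //; lra.
  rewrite big_split /= -!mulr_sumr; have := mm_dev f; have := mm_dev f'.
  by move=> h1 h2; apply: lerD; rewrite ler_wpM2l //; lra.
Qed.

(** All the mass can be put on an index with [b i <= beta]. *)
Lemma dual_bounded : exists M, forall y, 0 <= y -> dual y <= M.
Proof.
have [i ilt bi] := exists_b_le wf.
exists (\sum_(k < n) sg k * `|(k == Ordinal ilt)%:R - pb k|) => y y0.
apply: weak_duality => //.
- by rewrite (bigD1 (Ordinal ilt)) //= eqxx big1 ?addr0 // => k /negPf ->.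
- rewrite (bigD1 (Ordinal ilt)) //= eqxx mulr1 big1 ?addr0 // => k /negPf ->.
  by rewrite mulr0.
Qed.

(** The rate at which moving the mass of [i] to [j] becomes profitable,
    when [b j < b i]. *)
Definition crossing (j i : nat) := (sg i + sg j) / (b i - b j).

(** On an interval where the envelope is the line [j], [dual] can only bend at the
    crossings with [j].  If its value at some [y] exceeded [V], the affine piece
    through [y] would increase, as it starts at a point where the bound holds; and it
    could neither end at such a point nor, [dual] being bounded, go on forever. *)
Lemma le_between_crossings (V : R) j (x0 : R) (hi : option R) (y : R) :
  (j < n)%N -> 0 <= x0 -> dual x0 <= V ->
  (if hi is Some x1 then dual x1 <= V else true) ->
  (forall z, x0 <= z -> (if hi is Some x1 then z <= x1 else true) ->
     envelope z = line j z) ->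
  (forall i, (i < n)%N -> b j < b i -> dual (crossing j i) <= V) ->
  x0 <= y -> (if hi is Some x1 then y <= x1 else true) ->
  dual y <= V.
Proof.
move=> jn x0_ge0 Vx0 Vhi envE Vc x0y yhi; rewrite leNgt; apply/negP => Vy.
have y0 : 0 <= y by apply: le_trans x0y.
(* [A] extends the affine piece of [dual] through [y], whose slope is [Q]. *)
pose Q := - beta + \sum_(i < n) pb i *
  (if y * b i <= sg i + line j y then b i else b j).
pose A z := dual y + (z - y) * Q.
have dualA z : x0 <= z -> (if hi is Some x1 then z <= x1 else true) ->
    (forall i, (i < n)%N -> b j < b i ->
      (crossing j i < y -> crossing j i <= z) /\
      (y < crossing j i -> z <= crossing j i)) ->
    dual z = A z.
  move=> x0z zhi sep; rewrite /A /Q mulrDr mulr_sumr /dual !envE //.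
  have z0 : 0 <= z by apply: le_trans x0z.
  suff term (i : 'I_n) : pb i * Num.min (z * b i) (sg i + line j z) =
      pb i * Num.min (y * b i) (sg i + line j y) +
      (z - y) * (pb i * (if y * b i <= sg i + line j y then b i else b j)).
    by rewrite (eq_bigr _ (fun i _ => term i)) big_split /=; ring.
  have si := sg_gt0 wf (ltn_ord i); have sj := sg_gt0 wf jn.
  have -> : Num.min (z * b i) (sg i + line j z) =
     if y * b i <= sg i + line j y then z * b i else sg i + line j z.
    rewrite /line; case: (leP (y * b i)) => le.
      rewrite min_l //; case: (leP (b i) (b j)) => bij.
        by have : z * b i <= z * b j; [rewrite ler_wpM2l|lra].
      have bij0 : 0 < b i - b j by lra.
      have yc : y <= crossing j i by rewrite ler_pdivlMr //; lra.
      have {}yc : y < crossing j i.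
        rewrite lt_neqAle yc andbT; apply: contraTneq Vy => ->.
        by rewrite -leNgt; apply: Vc.
      have := (sep i (ltn_ord i) bij).2 yc.
      by rewrite ler_pdivlMr //; lra.
    rewrite min_r //; case: (leP (b i) (b j)) => bij.
      by have : y * b i <= y * b j; [rewrite ler_wpM2l|lra].
    have bij0 : 0 < b i - b j by lra.
    have yc : crossing j i < y by rewrite ltr_pdivrMr //; lra.
    have := (sep i (ltn_ord i) bij).1 yc.
    by rewrite ler_pdivrMr //; lra.
  by rewrite /line; case: (leP (y * b i)) => _; ring.
(* The largest bending point below [y]. *)
pose a := \big[Num.max/x0]_(i < n | (b j < b i) && (crossing j i < y)) crossing j i.
have a_le i : (i < n)%N -> b j < b i -> crossing j i < y -> crossing j i <= a.
  move=> lin bij cy; rewrite /a (bigD1 (Ordinal lin)) /= ?bij //.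
  by rewrite le_max lexx.
have x0_neq_y : x0 < y.
  by rewrite lt_neqAle x0y andbT; apply: contraTneq Vy => <-; rewrite -leNgt.
have [x0a ay Va] : [/\ x0 <= a, a < y & dual a <= V].
  rewrite /a; elim/big_rec: _ => [//|i c /andP[bij cy] [x0c lcy Vc']].
  by rewrite /Num.max; case: ltP => h; split=> //; [exact: le_trans h|exact: Vc].
have aA : dual a = A a.
  apply: dualA => //.
    by case: (hi) yhi => // x1; apply: le_trans; apply: ltW.
  move=> i lin bij; split=> cy; first exact: a_le.
  by rewrite ltW // (lt_trans ay).
have Q_gt0 : 0 < Q.
  have : 0 < (y - a) * Q by move: aA Va; rewrite /A => -> ?; lra.
  by rewrite pmulr_rgt0 //; lra.
have [M boundM] := dual_bounded.
have A_gt_V z : y <= z -> V < A z.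
  move=> yz; have : 0 <= (z - y) * Q by rewrite mulr_ge0 ?(ltW Q_gt0) //; lra.
  by rewrite /A; lra.
(* A point to the right of [y] which cannot be on the affine piece: the end of the
   interval if there is one, otherwise a point where [A] exceeds every value of
   [dual]. *)
have [z0 [yz0 z0hi z0A]] : exists z0,
    [/\ y <= z0, (if hi is Some x1 then z0 <= x1 else true) & dual z0 < A z0].
  case: (hi) Vhi yhi => [x1 Vx1 yx1|_ _].
    by exists x1; split=> //; apply: le_lt_trans Vx1 (A_gt_V _ yx1).
  have My := boundM y y0.
  have w0 : 0 <= (M + 1 - dual y) / Q by rewrite divr_ge0 ?(ltW Q_gt0) //; lra.
  exists (y + (M + 1 - dual y) / Q); split=> //; first by lra.
  apply: le_lt_trans (boundM _ _) _; first by lra.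
  by rewrite /A [y + _]addrC addrK mulfVK ?gt_eqF //; lra.
pose z := \big[Num.min/z0]_(i < n | (b j < b i) && (y < crossing j i)) crossing j i.
have z_le i : (i < n)%N -> b j < b i -> y < crossing j i -> z <= crossing j i.
  move=> lin bij cy; rewrite /z (bigD1 (Ordinal lin)) /= ?bij //.
  by rewrite ge_min lexx.
have [yz zz0 zA] : [/\ y <= z, z <= z0 & dual z < A z].
  rewrite /z; elim/big_rec: _ => [//|i c /andP[bij cy] [yc cz0 cA]].
  rewrite /Num.min; case: ltP => h; split=> //; first exact: ltW.
    exact: le_trans (ltW h) cz0.
  by apply: le_lt_trans (A_gt_V _ (ltW cy)); apply: Vc.
suff zE : dual z = A z by rewrite zE ltxx in zA.
apply: dualA; first exact: le_trans x0y yz.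
  by case: (hi) z0hi => // x1; apply: le_trans.
move=> i lin bij; split=> cy; last exact: z_le.
by rewrite (le_trans (ltW cy)).
Qed.

End Duality.

(** * Registers and notation for programs *)

(** Integer and real registers, real arrays and integer arrays.  The registers
    [iZero] and [rZero] are never written and keep their initial value 0; [rRemoved]
    holds -1, a key below all the keys that get sorted.  The arrays [aKey] and
    [aTree] hold the tournament tree: the nodes [n + i] are its leaves, node 1 is its
    root and the children of node [u] are [2 u] and [2 u + 1].  This is a binary tree
    with [n] leaves even when [n] is not a power of two. *)
Notation iN := 0%N (only parsing).
Notation iOne := 1%N (only parsing).
Notation iTwo := 2%N (only parsing).
Notation iI := 3%N (only parsing).
Notation iJ := 4%N (only parsing).
Notation iV := 5%N (only parsing).
Notation iA := 6%N (only parsing).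
Notation iC := 7%N (only parsing).
Notation iT := 8%N (only parsing).
Notation iZero := 9%N (only parsing).
Notation iLo := 10%N (only parsing).
Notation iHi := 11%N (only parsing).
Notation iMid := 12%N (only parsing).
Notation iLo1 := 13%N (only parsing).
Notation iTop := 14%N (only parsing).
Notation iK := 15%N (only parsing).
Notation iK1 := 16%N (only parsing).
Notation iO := 17%N (only parsing).
Notation iTop1 := 18%N (only parsing).
Notation iP := 19%N (only parsing).
Notation rBeta := 0%N (only parsing).
Notation rBest := 1%N (only parsing).
Notation rX := 2%N (only parsing).
Notation rM := 3%N (only parsing).
Notation rMb := 4%N (only parsing).
Notation rVal := 5%N (only parsing).
Notation rSlope := 6%N (only parsing).
Notation r1 := 7%N (only parsing).
Notation r2 := 8%N (only parsing).
Notation r3 := 9%N (only parsing).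
Notation r4 := 10%N (only parsing).
Notation r5 := 11%N (only parsing).
Notation rZero := 12%N (only parsing).
Notation rRemoved := 13%N (only parsing).
Notation rSgP := 14%N (only parsing).
Notation rBP := 15%N (only parsing).
Notation aSg := 0%N (only parsing).
Notation aPb := 1%N (only parsing).
Notation aB := 2%N (only parsing).
Notation aKey := 3%N (only parsing).
Notation aX := 4%N (only parsing).
Notation aD := 5%N (only parsing).
Notation aTree := 0%N (only parsing).
Notation aOrd := 1%N (only parsing).
Notation aStack := 2%N (only parsing).

Notation "c ;; P" := (Seq (Do c) P) (at level 65, right associativity).

(** * Sorting with a tournament tree *)


Definition copy_child a r :=
  NLoad iT aTree a ;; NStore aTree iV iT ;; Do (RStore aKey iV r).

Definition pull :=
  NAdd iA iV iV ;; NAdd iC iA iOne ;;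
  RLoad r1 aKey iA ;; RLoad r2 aKey iC ;;
  If (RLe r2 r1) (copy_child iA r1) (copy_child iC r2).

Notation "P ;+ Q" := (Seq P Q) (at level 65, right associativity).

Ltac exec_simpl := rewrite /= /set_nvar /set_narr /set_rvar /set_rarr /upd /=.
Ltac exec_step := apply: wp_step; exec_simpl.
Ltac exec_last := apply: wp_do; exec_simpl.

Definition set_leaves := For iOne iI iN (NAdd iA iN iI ;; Do (NStore aTree iA iI)).

(** The last iteration treats node 0, which lies outside the tree; this is
    harmless and saves a test. *)
Definition build := For iOne iI iN (NMove iV iI ;; pull).

(** Restores the tree along the path from a changed leaf to the root. *)
Definition sift := While (NLe iTwo iV) (NHalf iV iV ;; pull).

Definition extract :=
  NLoad iI aTree iOne ;; NStore aOrd iJ iI ;;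
  RLoad r1 aKey iOne ;; RStore aD iJ r1 ;;
  NAdd iV iN iI ;; RStore aKey iV rRemoved ;; sift.

Definition sort_keys := set_leaves ;+ build ;+ For iOne iJ iN extract.

(** The number of halvings that bring [n] down to zero. *)
Definition lg n := (trunc_log 2 n).+1.

Lemma lt_exp_lg n : (n < 2 ^ lg n)%N.
Proof. exact: trunc_log_ltn. Qed.

Section Tournament.
Variable R : realType.
Implicit Types (s : state R) (key : nat -> R) (tree : nat -> nat) (n u v : nat).

(** Every node carries the key of its winner next to the index of the winner.  The
    condition on a node then mentions no node other than its children, and changing
    a node can only break the conditions of that node and of its parent. *)
Definition node key tree u :=
  [/\ exists2 c, c \in [:: u + u; u + u + 1]%N & key u = key c /\ tree u = tree c,
      key (u + u)%N <= key u & key (u + u + 1)%N <= key u].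

Lemma eq_node key tree key' tree' u :
  (forall c, c \in [:: u; u + u; u + u + 1]%N ->
     key' c = key c /\ tree' c = tree c) ->
  node key tree u -> node key' tree' u.
Proof.
move=> e [[c cin [ek et]] h1 h2].
have [k0 t0] : key' u = key u /\ tree' u = tree u by apply: e; rewrite inE eqxx.
have [|k1 t1] := e (u + u)%N; first by rewrite !inE eqxx orbT.
have [|k2 t2] := e (u + u + 1)%N; first by rewrite !inE eqxx !orbT.
split; rewrite ?k0 ?t0 ?k1 ?k2 //; exists c => //.
have [|-> ->] := e c; last by [].
by rewrite inE cin orbT.
Qed.

Lemma node_unaffected key tree key' tree' v u :
  (forall c, c != v -> key' c = key c) -> (forall c, c != v -> tree' c = tree c) ->
  u != v -> u != v./2 -> node key tree u -> node key' tree' u.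
Proof.
move=> ek et uv uv2; apply: eq_node => c.
by rewrite !inE => /or3P[] /eqP ->; rewrite ek ?et //; lia.
Qed.

(** Going down from the root the winner is preserved until a leaf is reached, and
    going up from a leaf the keys increase. *)
Lemma root_is_max key tree n : (0 < n)%N ->
  (forall u, (0 < u < n)%N -> node key tree u) ->
  (forall i, (i < n)%N -> tree (n + i)%N = i) ->
  [/\ (tree 1 < n)%N, key 1%N = key (n + tree 1)%N &
      forall i, (i < n)%N -> key (n + i)%N <= key 1%N].
Proof.
move=> n0 nodes leaves.
have down u : (0 < u < n + n)%N -> (tree u < n)%N /\ key u = key (n + tree u)%N.
  have [m] := ubnP (n + n - u); elim: m u => // m IHm u um /andP[u0 u2n].
  case: (ltnP u n) => un; last first.
    by rewrite -(subnKC un) leaves; [split=> //|]; lia.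
  have [|[c cin [-> ->]] _ _] := nodes u; first by rewrite u0.
  by apply: IHm; move: cin; rewrite !inE; lia.
have up u : (0 < u < n + n)%N -> key u <= key 1%N.
  elim/ltn_ind: u => u IHu /andP[u0 u2n]; case: (ltngtP u 1) => u1; first by lia.
    have [|_ h1 h2] := nodes u./2; first by lia.
    apply: (@le_trans _ _ (key u./2)); last by apply: IHu; lia.
    have : u = (u./2 + u./2)%N \/ u = (u./2 + u./2 + 1)%N by lia.
    by case=> {1}->.
  by rewrite u1.
have [|t1 k1] := down 1%N; first by lia.
by split=> // i lin; apply: up; lia.
Qed.

Lemma pull_spec s : nvar s iOne = 1%N ->
  wp pull 8 (fun s' => [/\ (0 < nvar s iV)%N -> node (rarr s' aKey) (narr s' aTree) (nvar s iV),
     forall u, u != nvar s iV -> rarr s' aKey u = rarr s aKey u &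
     forall u, u != nvar s iV -> narr s' aTree u = narr s aTree u]) s.
Proof.
set v := nvar s iV => one; rewrite /pull; do 4 exec_step; rewrite one -/v.
apply: wp_if => /= h; rewrite /copy_child; do 2 exec_step; exec_last;
  rewrite -/v; split; try by move=> u /negPf ->.
all: move=> v0; have v2 : (v + v == v)%N = false by lia.
all: have v21 : (v + v + 1 == v)%N = false by lia.
  split; rewrite !eqxx ?v2 ?v21 //; exists (v + v)%N; rewrite ?inE ?eqxx //.
  by rewrite v2.
move: h; rewrite -ltNge => /ltW h.
split; rewrite !eqxx ?v2 ?v21 //; exists (v + v + 1)%N; rewrite ?inE ?eqxx ?orbT //.
by rewrite v21.
Qed.

Lemma sift_spec s n m :
  nvar s iOne = 1%N -> nvar s iTwo = 2%N ->
  (nvar s iV < n + n)%N -> (nvar s iV < 2 ^ m)%N ->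
  (forall u, (0 < u < n)%N -> u != (nvar s iV)./2 ->
     node (rarr s aKey) (narr s aTree) u) ->
  wp sift (m * 10 + 1) (fun s' =>
    [/\ forall u, (0 < u < n)%N -> node (rarr s' aKey) (narr s' aTree) u,
        forall u, (n <= u)%N -> rarr s' aKey u = rarr s aKey u &
        forall u, (n <= u)%N -> narr s' aTree u = narr s aTree u]) s.
Proof.
move=> one two v2n v2m nodes.
pose Inv m s' :=
  [/\ (nvar s' iV < n + n)%N, (nvar s' iV < 2 ^ m)%N,
      forall u, (0 < u < n)%N -> u != (nvar s' iV)./2 ->
        node (rarr s' aKey) (narr s' aTree) u,
      forall u, (n <= u)%N -> rarr s' aKey u = rarr s aKey u &
      forall u, (n <= u)%N -> narr s' aTree u = narr s aTree u].
apply: (@wp_call _ _ _ _ (fun s' => (exists m', Inv m' s') /\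
   ~~ holds (NLe iTwo iV) s')).
- apply: (@wp_while _ _ _ 9 Inv m) => // m' s' fr [h1 h2 h3 h4 h5] /=.
  rewrite (frame_nvar fr) // two => v2.
  have one' : nvar s' iOne = 1%N by rewrite (frame_nvar fr).
  exec_step; apply: (@wp_call _ _ 8); [exact: pull_spec|by []|].
  move=> s'' fr' /= [p1 p2 p3]; have {}p1 := p1 ltac:(lia); exists m'.-1.
    by case: m' h2 => //; rewrite expn0; lia.
  rewrite /Inv (frame_nvar fr') //=; split.
  + by lia.
  + by case: m' h2 => [|m']; rewrite ?expn0 ?expnS /=; lia.
  + move=> u un uv; case: (eqVneq u (nvar s' iV)./2) => [->//|uv'].
    by apply: (node_unaffected p2 p3) => //; apply: h3.
  + by move=> u un; rewrite p2 ?h4 //; lia.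
  + by move=> u un; rewrite p3 ?h5 //; lia.
- by [].
move=> s' fr [[m' [h1 h2 h3 h4 h5]] /=]; rewrite (frame_nvar fr) // two => v2.
by split=> // u un; apply: h3 => //; lia.
Qed.

End Tournament.

Section Sorting.
Variable R : realType.
Implicit Types s : state R.

(** Maxima are extracted first and stored last, at decreasing positions. *)
Definition extracted s n j := [seq narr s aOrd k | k <- iota j (n - j)].

Record extract_inv (K : nat -> R) n j s : Prop := ExtractInv {
  ei_node : forall u, (0 < u < n)%N -> node (rarr s aKey) (narr s aTree) u;
  ei_leaf : forall i, (i < n)%N -> narr s aTree (n + i)%N = i;
  ei_key : forall i, (i < n)%N ->
    rarr s aKey (n + i)%N = if i \in extracted s n j then -1 else K i;
  ei_uniq : uniq (extracted s n j);
  ei_lt : forall k, (j <= k < n)%N -> (narr s aOrd k < n)%N;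
  ei_out : forall k, (j <= k < n)%N -> rarr s aD k = K (narr s aOrd k);
  ei_sorted : forall k k', (j <= k <= k')%N -> (k' < n)%N ->
    rarr s aD k <= rarr s aD k';
  ei_rest : forall i k, (i < n)%N -> i \notin extracted s n j ->
    (j <= k < n)%N -> K i <= rarr s aD k
}.

(** The pigeonhole principle. *)
Lemma exists_not_extracted n j s : (j < n)%N ->
  exists2 i, (i < n)%N & i \notin extracted s n j.+1.
Proof.
move=> jn; apply: contrapT => all_in.
have : (size (iota 0 n) <= size (extracted s n j.+1))%N.
  apply: uniq_leq_size; first exact: iota_uniq.
  move=> i; rewrite mem_iota => /andP[_ lin]; apply: contrapT => /negP nin.
  by apply: all_in; exists i.
by rewrite size_map !size_iota; lia.
Qed.

Lemma extract_spec (K : nat -> R) n j s :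
  nvar s iN = n -> nvar s iOne = 1%N -> nvar s iTwo = 2%N -> nvar s iJ = j ->
  rvar s rRemoved = -1 -> (forall i, (i < n)%N -> 0 <= K i) -> (j < n)%N ->
  extract_inv K n j.+1 s ->
  wp extract (6 + ((lg n).+1 * 10 + 1)) (extract_inv K n j) s.
Proof.
move=> en one two ej rem K0 jn inv; rewrite /extract.
have [t1 k1 max1] := root_is_max (leq_ltn_trans (leq0n j) jn) (ei_node inv) (ei_leaf inv).
set i := narr s aTree 1 in t1 k1 max1.
have [i' lin' nin'] := exists_not_extracted s jn.
have nin : i \notin extracted s n j.+1.
  apply/negP => iin; have := max1 _ lin'; rewrite k1 !(ei_key inv) // iin (negPf nin').
  by have := K0 _ lin'; lra.
have key1 : rarr s aKey 1 = K i by rewrite k1 (ei_key inv) // (negPf nin).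
do 6 exec_step; rewrite en ej one -/i rem.
have h2 : (2 ^ (lg n).+1 = 2 ^ lg n + 2 ^ lg n)%N by rewrite expnS mul2n addnn.
have hlg := lt_exp_lg n.
apply: wp_call (_ : (_ <= _)%N) _; [apply: (@sift_spec _ _ n (lg n).+1) => //=| by [] |].
- by rewrite ltn_add2l.
- by lia.
- move=> u un uv; apply: node_unaffected (ei_node inv un); last exact: uv.
  + by move=> c /negPf; rewrite /= => ->.
  + by move=> c _.
  + by lia.
move=> s' fr /= [nodes keys trees].
have ordE : narr s' aOrd = upd (narr s aOrd) j i by rewrite (frame_narr fr).
have DE : rarr s' aD = upd (rarr s aD) j (K i) by rewrite (frame_rarr fr) //= key1.
have outE : extracted s' n j = i :: extracted s n j.+1.
  rewrite /extracted -(subnSK jn) /= ordE /upd eqxx; congr (_ :: _).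
  by apply/eq_in_map => k; rewrite mem_iota => kj; case: eqP => // ?; lia.
split=> //.
- by move=> l lln; rewrite trees ?(ei_leaf inv) //; lia.
- move=> l lln; rewrite keys ?leq_addr // eqn_add2l outE inE (ei_key inv) //.
  by case: eqP.
- by rewrite outE /= nin (ei_uniq inv).
- move=> k kj; rewrite ordE /upd; case: eqP => // kj'.
  by apply: (ei_lt inv); lia.
- move=> k kj; rewrite DE ordE /upd; case: eqP => // kj'.
  by apply: (ei_out inv); lia.
- move=> k k' kk' k'n; rewrite DE /upd; case: (eqVneq k' j) => k'j.
    by have -> : (k == j)%N by lia.
  case: (eqVneq k j) => kj; first by apply: (ei_rest inv) => //; lia.
  by apply: (ei_sorted inv) => //; lia.
- move=> l k lln; rewrite outE inE negb_or => /andP[li lnin] kj.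
  rewrite DE /upd; case: eqP => kj'; last by apply: (ei_rest inv) => //; lia.
  by have := max1 _ lln; rewrite key1 (ei_key inv) // (negPf lnin).
Qed.

(** The keys must be nonnegative so that the mark -1 of an extracted leaf loses
    against all others; that the order hits every index holds because [n] distinct
    indices below [n] are extracted. *)
Lemma sort_keys_spec s n :
  (0 < n)%N -> nvar s iN = n -> nvar s iOne = 1%N -> nvar s iTwo = 2%N ->
  rvar s rRemoved = -1 -> (forall i, (i < n)%N -> 0 <= rarr s aKey (n + i)%N) ->
  wp sort_keys (50 * (n * lg n)) (fun s' =>
    [/\ forall k, (k < n)%N -> (narr s' aOrd k < n)%N /\
          rarr s' aD k = rarr s aKey (n + narr s' aOrd k)%N,
        forall k k', (k <= k')%N -> (k' < n)%N -> rarr s' aD k <= rarr s' aD k' &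
        forall i, (i < n)%N -> exists2 k, (k < n)%N & narr s' aOrd k = i]) s.
Proof.
move=> n0 en one two rem K0; pose K i := rarr s aKey (n + i)%N.
apply: (@wp_call _ _ ((n * 4 + 2) + ((n * 11 + 2) +
  (n * (6 + ((lg n).+1 * 10 + 1)).+2 + 2))) _ (extract_inv K n 0)); last first.
- move=> s' _ inv.
  have mem_ext : extracted s' n 0 =i iota 0 n.
    apply: (uniq_min_size (ei_uniq inv) _ _).2.
    + move=> x /mapP[k]; rewrite mem_iota subn0 => kn ->.
      by rewrite mem_iota; apply: (ei_lt inv).
    + by rewrite size_map !size_iota subn0.
  split.
  + by move=> k kn; rewrite (ei_lt inv) // (ei_out inv).
  + by move=> k k' kk' k'n; apply: (ei_sorted inv).
  + move=> i lin; have : i \in iota 0 n by rewrite mem_iota.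
    by rewrite -mem_ext => /mapP[k]; rewrite mem_iota subn0 => kn ->; exists k.
- rewrite /lg; set l := trunc_log _ _; nia.
apply: wp_seq; apply: (@wp_call _ _ _ _ (fun s' => forall i, (0 <= i < n)%N ->
    narr s' aTree (n + i)%N = i)).
- apply: (@wp_for _ _ _ _ _ 2 (fun j s' =>
    forall i, (j <= i < n)%N -> narr s' aTree (n + i)%N = i) n) => //.
    by move=> i; lia.
  move=> j s' _ ej fr inv; exec_step; exec_last => i jin.
  rewrite (frame_nvar fr) // en ej eqn_add2l; case: eqP => // ij.
  by apply: inv; lia.
- by [].
move=> s1 fr1 leaves.
have en1 : nvar s1 iN = n by rewrite (frame_nvar fr1).
have one1 : nvar s1 iOne = 1%N by rewrite (frame_nvar fr1).
apply: wp_seq; apply: (@wp_call _ _ _ _ (fun s' =>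
  [/\ forall u, (0 < u)%N -> (0 <= u < n)%N -> node (rarr s' aKey) (narr s' aTree) u,
      forall i, (i < n)%N -> narr s' aTree (n + i)%N = i &
      forall i, (i < n)%N -> rarr s' aKey (n + i)%N = K i])).
- apply: (@wp_for _ _ _ _ _ 9 (fun j s' =>
    [/\ forall u, (0 < u)%N -> (j <= u < n)%N -> node (rarr s' aKey) (narr s' aTree) u,
        forall i, (i < n)%N -> narr s' aTree (n + i)%N = i &
        forall i, (i < n)%N -> rarr s' aKey (n + i)%N = K i]) n) => //.
  + split; first by move=> u; lia.
    * by move=> i; apply: leaves.
    * by move=> i lin; rewrite (frame_rarr fr1).
  + move=> j s' jn ej fr [nodes lv ks]; exec_step; rewrite ej.
    have one' : nvar s' iOne = 1%N by rewrite (frame_nvar fr).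
    apply: (@wp_call _ _ 8); [exact: pull_spec|by []|].
    move=> s'' fr' /= [p1 p2 p3]; split.
    * move=> u u0 un; case: (eqVneq u j) => [uj|uj].
        by move: u0; rewrite uj; apply: p1.
      by apply: (node_unaffected p2 p3) => //; [lia|apply: nodes => //; lia].
    * by move=> i lin; rewrite p3 ?lv //; lia.
    * by move=> i lin; rewrite p2 ?ks //; lia.
- by [].
move=> s2 fr2 [nodes lv ks].
have no_out : extracted s2 n n = [::] by rewrite /extracted subnn.
apply: (@wp_for _ _ _ _ _ (6 + ((lg n).+1 * 10 + 1)) (extract_inv K n) n) => //.
- by rewrite (frame_nvar fr2).
- by rewrite (frame_nvar fr2).
- by move=> j v s' [].
- split; rewrite ?no_out //.
  + by move=> u /andP[u0 un]; apply: nodes.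
  + by move=> k; lia.
  + by move=> k; lia.
  + by move=> k k'; lia.
  + by move=> i k; lia.
- move=> j s' jn ej fr inv; apply: extract_spec => //.
  + by rewrite (frame_nvar fr) // (frame_nvar fr2).
  + by rewrite (frame_nvar fr) // (frame_nvar fr2).
  + by rewrite (frame_nvar fr) // (frame_nvar fr2) // (frame_nvar fr1).
  + by rewrite (frame_rvar fr) // (frame_rvar fr2) // (frame_rvar fr1).
Qed.

End Sorting.

(** * Evaluating and maximising the dual *)

Definition min_line :=
  RLoad r1 aSg iZero ;; RLoad rMb aB iZero ;; RMul r2 rX rMb ;; RAdd rM r1 r2 ;;
  For iOne iI iN
    (RLoad r1 aSg iI ;; RLoad r2 aB iI ;; RMul r3 rX r2 ;; RAdd r3 r1 r3 ;;
     If (RLe rM r3) Skip (RMove rM r3 ;; Do (RMove rMb r2))).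

Definition add_term t c :=
  RMul t r1 t ;; RAdd rVal rVal t ;; RMul r5 r1 c ;; Do (RAdd rSlope rSlope r5).

Definition eval_dual :=
  min_line ;+
  RMul r1 rX rBeta ;; RSub rVal rZero r1 ;; RSub rSlope rZero rBeta ;;
  For iOne iI iN
    (RLoad r1 aPb iI ;; RLoad r2 aB iI ;; RLoad r3 aSg iI ;;
     RMul r4 rX r2 ;; RAdd r3 r3 rM ;;
     If (RLe r4 r3) (add_term r4 r2) (add_term r3 rMb)).

(** Finds the first point of the sorted array [arr] where the supergradient is
    negative, recording the best value of the dual met on the way. *)
Definition search arr cnt :=
  NMove iHi cnt ;; NMove iLo iZero ;; NMove iLo1 iOne ;;
  While (NLe iLo1 iHi)
    (NAdd iMid iLo iHi ;; NHalf iMid iMid ;; RLoad rX arr iMid ;;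
     eval_dual ;+
     If (RLe rBest rVal) (Do (RMove rBest rVal)) Skip ;+
     If (RLe rZero rSlope) (Do (NAdd iLo iMid iOne)) (Do (NMove iHi iMid)) ;+
     Do (NAdd iLo1 iLo iOne)).

Section Search.
Variables (R : realType) (n : nat) (sg pb b : nat -> R) (beta : R).
Implicit Types s : state R.
Local Notation dual := (dual n sg pb b beta).

(** The constants and the data, which no fragment changes once they are set up. *)
Record loaded s : Prop := Loaded {
  ld_n : nvar s iN = n;
  ld_one : nvar s iOne = 1%N;
  ld_two : nvar s iTwo = 2%N;
  ld_zero : nvar s iZero = 0%N;
  ld_rzero : rvar s rZero = 0;
  ld_removed : rvar s rRemoved = -1;
  ld_beta : rvar s rBeta = beta;
  ld_sg : rarr s aSg = sg;
  ld_pb : rarr s aPb = pb;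
  ld_b : rarr s aB = b
}.

Definition keeps_data P := 
  [&& all (fun x => ~~ has_instr (sets_nvar x) P) [:: iN; iOne; iTwo; iZero],
      all (fun x => ~~ has_instr (sets_rvar x) P) [:: rZero; rRemoved; rBeta] &
      all (fun a => ~~ has_instr (sets_rarr a) P) [:: aSg; aPb; aB]].

Lemma loaded_frame P s s' : keeps_data P -> frame P s s' -> loaded s -> loaded s'.
Proof.
move=> /and3P[/= /and5P[n1 n2 n3 n4 _] /and4P[x1 x2 x3 _] /and4P[a1 a2 a3 _]] fr.
by case; split; rewrite ?(frame_nvar fr) ?(frame_rvar fr) ?(frame_rarr fr).
Qed.

Hypothesis wf : wf_data n sg pb b beta.

Lemma min_line_spec s : loaded s ->
  wp min_line (n * 9 + 6) (fun s' => rvar s' rM = envelope n sg b (rvar s rX) /\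
    exists j, [/\ (j < n)%N, rvar s' rM = line sg b j (rvar s rX) &
                  rvar s' rMb = b j]) s.
Proof.
move=> ld; have n0 := n_gt0 wf; set x := rvar s rX.
have -> : (n * 9 + 6 = (n * 9 + 2).+4)%N by lia.
do 4 exec_step; rewrite (ld_zero ld) (ld_sg ld) (ld_b ld) -/x.
pose Inv k s' := [/\ forall i, (k <= i < n)%N -> rvar s' rM <= line sg b i x
  & exists j, [/\ (j < n)%N, rvar s' rM = line sg b j x & rvar s' rMb = b j]].
apply: (@wp_call _ _ _ _ (Inv 0%N)).
- apply: (@wp_for _ _ _ _ _ 7 Inv n) => //.
  + exact: ld_n ld.
  + exact: ld_one ld.
  + by split=> [i|]; [lia|exists 0%N].
  + move=> k s' kn ek fr [le [j [jn ej bj]]].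
    have sgE : rarr s' aSg = sg by rewrite (frame_rarr fr) //= (ld_sg ld).
    have bE : rarr s' aB = b by rewrite (frame_rarr fr) //= (ld_b ld).
    have xE : rvar s' rX = x by rewrite (frame_rvar fr).
    do 4 exec_step; rewrite ek sgE bE xE -/(line sg b k x).
    apply: wp_if => /= h.
      apply: wp_skip; split; last by exists j.
      move=> i /=; case: (eqVneq i k) => [-> //|ik] ikn; apply: le; lia.
    exec_step; exec_last; split; last by exists k.
    move=> i /=; case: (eqVneq i k) => [-> //|ik] ikn.
    by apply: le_trans (le i _); [rewrite ltW // ltNge|lia].
- by [].
move=> s' fr [le [j [jn ej bj]]]; split; last by exists j.
by rewrite ej; symmetry; apply: (envelopeP wf) => // k kn; rewrite -ej; apply: le.
Qed.

Lemma eval_dual_spec s : loaded s ->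
  wp eval_dual (n * 21 + 11) (fun s' => rvar s' rVal = dual (rvar s rX) /\
    forall y, dual y <= dual (rvar s rX) + rvar s' rSlope * (y - rvar s rX)) s.
Proof.
move=> ld; set x := rvar s rX.
have -> : (n * 21 + 11 = (n * 9 + 6) + (n * 12 + 2).+3)%N by lia.
apply: wp_seq; apply: wp_call (min_line_spec ld) _ _; first by [].
move=> s1 fr1 [em [j [jn ej bj]]].
have ld1 : loaded s1 by apply: loaded_frame fr1 ld.
have xE : rvar s1 rX = x by rewrite (frame_rvar fr1).
rewrite -/x in em ej.
do 3 exec_step; rewrite (ld_rzero ld1) (ld_beta ld1) xE !sub0r.
pose Inv k s' :=
  rvar s' rVal = - (x * beta) + \sum_(k <= i < n)
    pb i * Num.min (x * b i) (sg i + envelope n sg b x) /\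
  rvar s' rSlope = - beta + \sum_(k <= i < n)
    pb i * (if x * b i <= sg i + envelope n sg b x then b i else b j).
apply: (@wp_call _ _ _ _ (Inv 0%N)).
- apply: (@wp_for _ _ _ _ _ 10 Inv n) => //.
  + exact: ld_n ld1.
  + exact: ld_one ld1.
  + by rewrite /Inv /= !big_geq // !addr0.
  + move=> k s' kn ek fr [ev es].
    have sgE : rarr s' aSg = sg by rewrite (frame_rarr fr) //= (ld_sg ld1).
    have bE : rarr s' aB = b by rewrite (frame_rarr fr) //= (ld_b ld1).
    have pbE : rarr s' aPb = pb by rewrite (frame_rarr fr) //= (ld_pb ld1).
    have xE' : rvar s' rX = x by rewrite (frame_rvar fr).
    have mE : rvar s' rM = envelope n sg b x by rewrite (frame_rvar fr).
    have mbE : rvar s' rMb = b j by rewrite (frame_rvar fr).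
    do 5 exec_step; rewrite ek sgE bE pbE xE' mE.
    apply: wp_if => /= h; rewrite /add_term; do 3 exec_step; exec_last;
      rewrite ?mbE /Inv /= ev es !(big_ltn kn) /=.
    * by rewrite min_l // h; split; ring.
    * rewrite -ltNge in h; rewrite min_r ?(ltW h) // leNgt h /=; split; ring.
- by [].
move=> s' fr [ev es].
have dE : rvar s' rVal = dual x by rewrite ev big_mkord.
split=> // y; have := dual_supergradient wf y jn (etrans (esym em) ej).
by rewrite es big_mkord.
Qed.

(** A point with a nonnegative supergradient dominates everything to its left, one
    with a negative supergradient everything to its right; so in the end only
    the gap before the point [iLo] is not dominated. *)
Lemma search_spec arr cnt N m s : loaded s -> nvar s cnt = N -> (N < 2 ^ m)%N ->
  (forall k k', (k <= k')%N -> (k' < N)%N -> rarr s arr k <= rarr s arr k') ->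
  (forall k, (k < N)%N -> 0 <= rarr s arr k) ->
  (exists2 y : R, 0 <= y & rvar s rBest = dual y) ->
  wp (search arr cnt) (m * (n * 21 + 20) + 4) (fun s' =>
    [/\ rvar s rBest <= rvar s' rBest,
        exists2 y : R, 0 <= y & rvar s' rBest = dual y,
        (nvar s' iLo <= N)%N,
        forall k (y : R), (k < nvar s' iLo)%N -> 0 <= y -> y <= rarr s arr k ->
          dual y <= rvar s' rBest &
        forall k (y : R), (nvar s' iLo <= k)%N -> (k < N)%N -> rarr s arr k <= y ->
          dual y <= rvar s' rBest]) s.
Proof.
move=> ld eN Nm sorted X0 att; set X := rarr s arr in sorted X0 *.
have -> : (m * (n * 21 + 20) + 4 = (m * (n * 21 + 20) + 1).+3)%N by lia.
do 3 exec_step; rewrite (ld_one ld) (ld_zero ld) eN.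
pose Inv m s' :=
  [/\ nvar s' iLo1 = (nvar s' iLo).+1, (nvar s' iLo <= nvar s' iHi <= N)%N,
      (nvar s' iHi - nvar s' iLo < 2 ^ m)%N, 
      rvar s rBest <= rvar s' rBest /\ exists2 y : R, 0 <= y & rvar s' rBest = dual y &
      (forall k (y : R), (k < nvar s' iLo)%N -> 0 <= y -> y <= X k ->
         dual y <= rvar s' rBest) /\
      (forall k (y : R), (nvar s' iHi <= k)%N -> (k < N)%N -> X k <= y ->
         dual y <= rvar s' rBest)].
set s0 := State _ _ _ _.
have ld0 : loaded s0 by case: ld.
apply: (@wp_call _ _ _ _ (fun s' => (exists m', Inv m' s') /\
   ~~ holds (NLe iLo1 iHi) s')).
- apply: (@wp_while _ _ _ (n * 21 + 19) Inv m).
    by split=> //=; [rewrite subn0|split=> // k y; lia].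
  move=> m' s1 fr1 [e1 lohi lm [best1 att1] [dlo dhi]] /=; rewrite e1 => lohi'.
  have ld1 : loaded s1 by apply: loaded_frame fr1 ld0.
  have -> : (n * 21 + 19 = ((n * 21 + 11) + (2 + (2 + 1))).+3)%N by lia.
  do 3 exec_step.
  have XE : rarr s1 arr = X by rewrite (frame_rarr fr1).
  rewrite XE; set mid := (_ + _)./2; set s2 := State _ _ _ _.
  have ld2 : loaded s2 by case: (ld1).
  apply: wp_seq; apply: wp_call (eval_dual_spec ld2) _ _; first by [].
  move=> s3 fr3 [ev sup]; rewrite [rvar s2 _]/= in ev sup.
  have lo3 : nvar s3 iLo = nvar s1 iLo by rewrite (frame_nvar fr3).
  have hi3 : nvar s3 iHi = nvar s1 iHi by rewrite (frame_nvar fr3).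
  have mid3 : nvar s3 iMid = mid by rewrite (frame_nvar fr3).
  have one3 : nvar s3 iOne = 1%N by rewrite (frame_nvar fr3) //= (ld_one ld1).
  have best3 : rvar s3 rBest = rvar s1 rBest by rewrite (frame_rvar fr3).
  have zero3 : rvar s3 rZero = 0 by rewrite (frame_rvar fr3) //= (ld_rzero ld1).
  have midN : (mid < N)%N by rewrite /mid; lia.
  have m'0 : (0 < m')%N by case: m' lm => // ; rewrite expn0; lia.
  have pow : (2 ^ m' = 2 ^ m'.-1 + 2 ^ m'.-1)%N.
    by rewrite -[m' in LHS](prednK m'0) expnS mul2n addnn.
  have X_mid := X0 _ midN.
  apply: wp_seq; apply: (@wp_call _ _ 2 _ (fun s4 =>
     [/\ rvar s1 rBest <= rvar s4 rBest, dual (X mid) <= rvar s4 rBest &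
         exists2 y : R, 0 <= y & rvar s4 rBest = dual y])).
  + apply: wp_if => /= h; first exec_last; last apply: wp_skip.
      by rewrite -best3 ev; split=> //; [rewrite -ev|exists (X mid)].
    by rewrite best3; split=> //; rewrite -ev -best3 ltW // ltNge.
  + by [].
  move=> s4 fr4 [b4 v4 att4].
  have sl4 : rvar s4 rSlope = rvar s3 rSlope by rewrite (frame_rvar fr4).
  apply: wp_seq; apply: wp_if; rewrite /= (frame_rvar fr4) // sl4 zero3 => h;
    exec_last; exec_last; exists m'.-1; rewrite ?prednK //;
    rewrite /Inv /= !(frame_nvar fr4) //= ?lo3 ?hi3 mid3 one3.
  + split=> //; [lia|rewrite /mid; lia|rewrite /mid; lia| |].
      by split=> //; apply: le_trans b4.
    split=> k y.
      rewrite addn1 ltnS => kmid y0 yX; apply: le_trans v4.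
      have := sorted _ _ kmid midN => XX; have := sup y.
      have : rvar s3 rSlope * (y - X mid) <= 0 by rewrite mulr_ge0_le0 //; lra.
      by lra.
    by move=> hik kN Xy; apply: le_trans b4; apply: dhi hik kN Xy.
  + split=> //; [by rewrite addn1|rewrite /mid; lia|rewrite /mid; lia| |].
      by split=> //; apply: le_trans b4.
    split=> k y.
      by move=> klo y0 yX; apply: le_trans b4; apply: dlo klo y0 yX.
    move=> kmid kN yX; apply: le_trans v4.
    have := sorted _ _ kmid kN => XX; have := sup y; rewrite -ltNge in h.
    have : rvar s3 rSlope * (y - X mid) <= 0 by rewrite mulr_le0_ge0 ?(ltW h) //; lra.
    by lra.
- by rewrite -addnS.
move=> s' fr [[m' [e1 lohi _ [best att'] [dlo dhi]]]] /=; rewrite e1 => stop.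
have eq_lohi : nvar s' iHi = nvar s' iLo by lia.
by rewrite eq_lohi in dhi; split=> //; lia.
Qed.

End Search.

(** * The lower envelope of the lines *)

Definition push r :=
  RStore aX iTop r ;; NStore aStack iTop iO ;;
  NAdd iTop iTop iOne ;; Do (NMove iK iK1).

(** The lines enter by decreasing slope, so a new line is the lowest one for all
    large rates.  The top of the stack is removed if the new line is already below
    it where the top takes over from its predecessor; a new line parallel to the top
    and above it is skipped. *)
Definition scan :=
  NMove iK iN ;; NMove iTop iZero ;;
  While (NLe iOne iK)
    (NSub iK1 iK iOne ;; NLoad iO aOrd iK1 ;; RLoad r1 aSg iO ;; RLoad r2 aB iO ;;
     If (NLe iOne iTop)
       (NSub iTop1 iTop iOne ;; NLoad iP aStack iTop1 ;;
        RLoad r3 aSg iP ;; RLoad r4 aB iP ;; RLoad r5 aX iTop1 ;;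
        RSub r3 r1 r3 ;; RSub r4 r4 r2 ;; RMul r5 r5 r4 ;;
        If (RLe r3 r5) (Do (NMove iTop iTop1))
          (If (RLe r4 rZero) (Do (NMove iK iK1)) (RDiv r3 r3 r4 ;; push r3)))
       (push rZero)).

Section Hull.
Variables (R : realType) (n : nat) (sg b : nat -> R) (ord : nat -> nat).
Local Notation L := (line sg b).

(** [st q] is the lowest line on the stack between [X q] and [X q.+1].  This is split
    into [hull_right] and [hull_left], which compare two entries at a time: both
    survive the removal of the top, which extends the range of the entry below.
    [hull_cover] says that dropping lines is harmless, the next line to be read being
    allowed to stand in for those that it has removed. *)
Record hull_inv (k t : nat) (st : nat -> nat) (X : nat -> R) : Prop := HullInv {
  hull_le : (t + k <= n)%N;
  hull_stack : forall q, (q < t)%N -> exists2 i, (k <= i < n)%N & st q = ord i;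
  hull_cover : forall i (y : R), (k <= i < n)%N -> 0 <= y ->
    (exists2 q, (q < t)%N & L (st q) y <= L (ord i) y) \/
    ((0 < k)%N /\ L (ord k.-1) y <= L (ord i) y);
  hull_X0 : (0 < t)%N -> X 0%N = 0;
  hull_mono : forall q q', (q < q')%N -> (q' < t)%N -> X q < X q';
  hull_right : forall q q' (y : R), (q' < q)%N -> (q < t)%N -> X q <= y ->
    L (st q) y <= L (st q') y;
  hull_left : forall q q' (y : R), (q < q')%N -> (q' < t)%N -> y <= X q.+1 ->
    L (st q) y <= L (st q') y
}.

Hypothesis b_sorted : forall i i', (i <= i')%N -> (i' < n)%N -> b (ord i) <= b (ord i').

Lemma hull_X_ge0 k t st X q : hull_inv k t st X -> (q < t)%N -> 0 <= X q.
Proof.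
move=> inv qt; have <- : X 0%N = 0 by apply: (hull_X0 inv); lia.
by case: q qt => // q qt; rewrite ltW // (hull_mono inv).
Qed.

Lemma hull_init st X : hull_inv n 0 st X.
Proof. by split=> //; lia. Qed.

Lemma hull_push_first k st X : hull_inv k.+1 0 st X ->
  hull_inv k 1 (upd st 0%N (ord k)) (upd X 0%N 0).
Proof.
move=> inv; split; rewrite /upd //.
- by have := hull_le inv; lia.
- case=> // _; exists k => //=; have := hull_le inv; lia.
- move=> i y kin y0; left; exists 0%N => //=.
  case: (eqVneq i k) => [->//|ik].
  by case: (hull_cover inv (_ : (k.+1 <= i < n)%N) y0) => [|[]//|[_]//]; lia.
- by case=> [|q] [|q'].
- by case=> [|q] [|q'].
- by case=> [|q] [|q'].
Qed.

Lemma hull_pop k t st X : hull_inv k.+1 t.+1 st X ->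
  sg (ord k) - sg (st t) <= X t * (b (st t) - b (ord k)) ->
  hull_inv k.+1 t st X.
Proof.
move=> inv popped; have tk := hull_le inv.
have [i0 i0k est] := hull_stack inv (ltnSn t).
have bt : b (ord k) <= b (st t) by rewrite est; apply: b_sorted; lia.
split.
- by lia.
- by move=> q qt; apply: (hull_stack inv); lia.
- move=> i y kin y0; case: (hull_cover inv kin y0) => [[q qt le]|]; last by right.
  case: (eqVneq q t) => [qt'|qt']; last by left; exists q => //; lia.
  rewrite {}qt' in qt le.
  have [Xy|yX] := leP (X t) y.
    right; split=> //=; apply: le_trans le; rewrite /line.
    have : X t * (b (st t) - b (ord k)) <= y * (b (st t) - b (ord k)).
      by rewrite ler_wpM2r //; lra.
    by lra.
  left; case: t => [|t'] in tk inv popped est bt qt le yX *.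
    by have := hull_X0 inv isT; lra.
  exists t' => //; apply: le_trans le; apply: (hull_left inv) => //.
  exact: ltW.
- by move=> t0; apply: (hull_X0 inv); lia.
- by move=> q q' qq' q't; apply: (hull_mono inv) => //; lia.
- by move=> q q' y qq' qt; apply: (hull_right inv) => //; lia.
- by move=> q q' y qq' q't; apply: (hull_left inv) => //; lia.
Qed.

Lemma hull_skip k t st X : hull_inv k.+1 t.+1 st X ->
  X t * (b (st t) - b (ord k)) < sg (ord k) - sg (st t) ->
  b (st t) - b (ord k) <= 0 -> hull_inv k t.+1 st X.
Proof.
move=> inv above same; have tk := hull_le inv.
have [i0 i0k est] := hull_stack inv (ltnSn t).
have bt : b (ord k) <= b (st t) by rewrite est; apply: b_sorted; lia.
have bE : b (st t) = b (ord k) by lra.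
have sgE : sg (st t) <= sg (ord k) by move: above; rewrite bE subrr mulr0; lra.
have below y : L (st t) y <= L (ord k) y by rewrite /line bE; lra.
case: inv => h1 h2 h3 h4 h5 h6 h7; split=> //; first by lia.
- by move=> q qt; have [i ik ->] := h2 q qt; exists i => //; lia.
- move=> i y kin y0; left; case: (eqVneq i k) => [->|ik]; first by exists t.
  have [|//|[_ le]] := h3 i y _ y0; first by lia.
  by exists t => //; apply: le_trans le.
Qed.

Lemma hull_push k t st X : hull_inv k.+1 t.+1 st X ->
  X t * (b (st t) - b (ord k)) < sg (ord k) - sg (st t) ->
  0 < b (st t) - b (ord k) ->
  hull_inv k t.+2 (upd st t.+1 (ord k))
    (upd X t.+1 ((sg (ord k) - sg (st t)) / (b (st t) - b (ord k)))).
Proof.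
move=> inv above slope; have tk := hull_le inv.
set x := _ / _.
have Xx : X t < x by rewrite ltr_pdivlMr.
have new_below y : x <= y -> L (ord k) y <= L (st t) y.
  by rewrite ler_pdivrMr // /line; lra.
have new_above y : y <= x -> L (st t) y <= L (ord k) y.
  by rewrite ler_pdivlMr // /line; lra.
have X_le q : (q <= t)%N -> X q <= X t.
  by rewrite leq_eqVlt => /orP[/eqP->//|qt]; rewrite ltW // (hull_mono inv).
split; rewrite /upd.
- by lia.
- move=> q qt; case: eqP => qt'; first by exists k => //; lia.
  by have [|i ik ->] := hull_stack inv (_ : (q < t.+1)%N); [lia|exists i => //; lia].
- move=> i y kin y0; left; case: (eqVneq i k) => [->|ik].
    by exists t.+1 => //; rewrite eqxx.
  have [|[q qt le]|[_ le]] := hull_cover inv (_ : (k.+1 <= i < n)%N) y0.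
  + by lia.
  + by exists q; [lia|rewrite (_ : (q == t.+1) = false) //; lia].
  + by exists t.+1 => //; rewrite eqxx.
- by move=> _; apply: (hull_X0 inv).
- move=> q q' qq' q't; have -> : (q == t.+1) = false by lia.
  case: eqP => q't'; last by apply: (hull_mono inv) => //; lia.
  by apply: le_lt_trans Xx; apply: X_le; lia.
- move=> q q' y qq' qt; have -> : (q' == t.+1) = false by lia.
  case: eqP => qt'; last by apply: (hull_right inv) => //; lia.
  move=> xy; apply: le_trans (new_below y xy) _.
  case: (eqVneq q' t) => [->//|q't]; apply: (hull_right inv) => //; first by lia.
  by apply: le_trans xy; apply: ltW.
- move=> q q' y qq' q't; have -> : (q == t.+1) = false by lia.
  case: (eqVneq q' t.+1) => q't'; last first.
    have -> : (q.+1 == t.+1) = false by lia.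
    by apply: (hull_left inv) => //; lia.
  case: (eqVneq q.+1 t.+1) => [[->]|qt] yX; first exact: new_above.
  apply: le_trans (new_above y _); last first.
    by apply: le_trans yX _; apply: le_trans (ltW Xx); apply: X_le; lia.
  by apply: (hull_left inv) => //; lia.
Qed.

Lemma hull_final t st X : (0 < n)%N -> hull_inv 0 t st X ->
  (forall i, (i < n)%N -> exists2 k, (k < n)%N & ord k = i) ->
  (0 < t)%N /\
  forall q (y : R), (q < t)%N -> X q <= y -> ((q.+1 < t)%N -> y <= X q.+1) ->
    forall i, (i < n)%N -> L (st q) y <= L i y.
Proof.
move=> n0 inv onto; split.
  by have [|[q qt _]|[]//] := hull_cover inv (_ : (0 <= 0 < n)%N) (lexx 0); lia.
move=> q y qt Xy yX i lin; have [k kn <-] := onto i lin.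
have y0 : 0 <= y by apply: le_trans Xy; apply: hull_X_ge0 inv qt.
have [|[q' q't le]|[]//] := hull_cover inv (_ : (0 <= k < n)%N) y0; first by lia.
apply: le_trans le; case: (ltngtP q q') => [qq'|q'q|-> //].
  by apply: (hull_left inv) => //; apply: yX; lia.
exact: (hull_right inv).
Qed.

End Hull.

(** Each iteration reads a line, pushing at most one entry, or pops an entry, so
    twice the number of unread lines plus the height of the stack decreases. *)
Lemma scan_spec (R : realType) n (sg pb b : nat -> R) beta (s : state R) :
  loaded n sg pb b beta s -> (0 < n)%N ->
  (forall k, (k < n)%N -> (narr s aOrd k < n)%N) ->
  (forall i i', (i <= i')%N -> (i' < n)%N ->
     b (narr s aOrd i) <= b (narr s aOrd i')) ->
  (forall i, (i < n)%N -> exists2 k, (k < n)%N & narr s aOrd k = i) ->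
  wp scan (n * 45) (fun s' => [/\ (0 < nvar s' iTop <= n)%N,
     rarr s' aX 0%N = 0,
     forall q q', (q <= q')%N -> (q' < nvar s' iTop)%N ->
       rarr s' aX q <= rarr s' aX q',
     forall q, (q < nvar s' iTop)%N -> (narr s' aStack q < n)%N &
     forall q (y : R), (q < nvar s' iTop)%N -> rarr s' aX q <= y ->
       ((q.+1 < nvar s' iTop)%N -> y <= rarr s' aX q.+1) ->
       forall i, (i < n)%N -> line sg b (narr s' aStack q) y <= line sg b i y]) s.
Proof.
move=> ld n0 ord_lt sorted onto; set ord := narr s aOrd in ord_lt sorted onto.
apply: (@wp_call _ _ ((n + n) * 21 + 1).+2); last first.
- move=> s' _ H; exact: H.
- by lia.
do 2 exec_step; rewrite (ld_n ld) (ld_zero ld); set s0 := State _ _ _ _.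
have ld0 : loaded n sg pb b beta s0 by case: ld.
pose hull s' := hull_inv n sg b ord (nvar s' iK) (nvar s' iTop) (narr s' aStack) (rarr s' aX).
apply: (@wp_call _ _ _ _ (fun s' => (exists m, hull s' /\
   (nvar s' iK + nvar s' iK + nvar s' iTop <= m)%N) /\ ~~ holds (NLe iOne iK) s')).
- apply: (@wp_while _ _ _ 20 (fun m s' => hull s' /\
   (nvar s' iK + nvar s' iK + nvar s' iTop <= m)%N) (n + n)).
    by split; [exact: hull_init|rewrite /= addn0].
  move=> m s1 fr1 [inv lem] /=.
  have ld1 : loaded n sg pb b beta s1 by apply: loaded_frame fr1 ld0.
  rewrite (ld_one ld1); rewrite /hull in inv.
  case ek : (nvar s1 iK) inv lem => [//|k] inv lem _.
  have ordE : narr s1 aOrd = ord by rewrite (frame_narr fr1).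
  do 4 exec_step; rewrite (ld_one ld1) ek subn1 ordE (ld_sg ld1) (ld_b ld1) /=.
  apply: wp_if => /=; rewrite (ld_one ld1).
  + case et : (nvar s1 iTop) inv lem => [//|t] inv lem _.
    do 8 exec_step; rewrite (ld_one ld1) et subn1 (ld_sg ld1) (ld_b ld1) /=.
    apply: wp_if => /= h1.
      exec_last; exists m.-1; first by lia.
      rewrite /hull /= ek; split; last by lia.
      exact: hull_pop.
    rewrite -ltNge in h1; apply: wp_if => /=; rewrite (ld_rzero ld1) => h2.
      exec_last; exists m.-1; first by lia.
      by rewrite /hull /= et; split; [exact: hull_skip|lia].
    rewrite -ltNge in h2; exec_step; rewrite /push; do 3 exec_step; exec_last.
    rewrite (ld_one ld1) et addn1 gt_eqF //.
    exists m.-1; first by lia.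
    by rewrite /hull /=; split; [exact: hull_push|lia].
  + case et : (nvar s1 iTop) inv lem => [|//] inv lem _.
    rewrite /push; do 3 exec_step; exec_last.
    rewrite (ld_one ld1) et add0n (ld_rzero ld1).
    exists m.-1; first by lia.
    by rewrite /hull /=; split; [exact: hull_push_first|lia].
- by [].
move=> s' fr [[m [inv _]]] /=.
have ld' : loaded n sg pb b beta s' by apply: loaded_frame fr ld0.
rewrite (ld_one ld') lt0n negbK => /eqP ek; rewrite /hull ek in inv.
have [top0 env] := hull_final n0 inv onto.
split=> //.
- by have := hull_le inv; lia.
- exact: (hull_X0 inv).
- move=> q q'; rewrite leq_eqVlt => /orP[/eqP->//|qq' q't].
  by rewrite ltW // (hull_mono inv).
- by move=> q qt; have [i ik ->] := hull_stack inv qt; apply: ord_lt; lia.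
Qed.

(** * The complete program *)

Definition load_b_keys :=
  For iOne iI iN (NAdd iA iN iI ;; RLoad r1 aB iI ;; Do (RStore aKey iA r1)).

(** Indices that never cross the line found by the first search get the key 0, a
    point already dominated because [dual] vanishes there. *)
Definition load_crossing_keys :=
  NSub iTop1 iLo iOne ;; NLoad iP aStack iTop1 ;;
  RLoad rSgP aSg iP ;; RLoad rBP aB iP ;;
  For iOne iI iN
    (NAdd iA iN iI ;; RLoad r1 aB iI ;; RSub r1 r1 rBP ;;
     RLoad r2 aSg iI ;; RAdd r2 r2 rSgP ;;
     If (RLe r1 rZero) (Do (RStore aKey iA rZero))
       (RDiv r2 r2 r1 ;; Do (RStore aKey iA r2))).

(** The register [rBest] starts at 0, the value of the dual at the rate 0,
    which therefore need not be evaluated. *)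
Definition solve :=
  NConst iOne 1 ;; NConst iTwo 2 ;; RConst r1 1 ;; RSub rRemoved rZero r1 ;;
  load_b_keys ;+ sort_keys ;+ scan ;+ search aX iTop ;+
  load_crossing_keys ;+ sort_keys ;+ search aD iN ;+
  Do (RMove 0 rBest).

Section Main.
Variables (R : realType) (n : nat) (sg pb b : nat -> R) (beta : R).
Implicit Types s : state R.
Hypothesis wf : wf_data n sg pb b beta.
Local Notation dual := (dual n sg pb b beta).
Local Notation loaded := (loaded n sg pb b beta).

Lemma load_b_keys_spec s : loaded s ->
  wp load_b_keys (n * 5 + 2) (fun s' =>
    forall i, (i < n)%N -> rarr s' aKey (n + i)%N = b i) s.
Proof.
move=> ld; apply: (@wp_call _ _ _ _ (fun s' =>
  forall i, (0 <= i < n)%N -> rarr s' aKey (n + i)%N = b i)).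
- apply: (@wp_for _ _ _ _ _ 3 (fun j s' =>
    forall i, (j <= i < n)%N -> rarr s' aKey (n + i)%N = b i) n) => //.
  + exact: ld_n ld.
  + exact: ld_one ld.
  + by move=> i; lia.
  + move=> j s' jn ej fr inv; have ld' : loaded s' by apply: loaded_frame fr ld.
    do 2 exec_step; exec_last => i jin.
    rewrite (ld_n ld') ej (ld_b ld') eqn_add2l; case: eqP => [->//|ij].
    by apply: inv; lia.
- by [].
by move=> s' _ inv i; apply: inv.
Qed.

Lemma load_crossing_keys_spec s : loaded s ->
  wp load_crossing_keys (n * 10 + 6) (fun s' =>
    let p := narr s aStack (nvar s iLo - 1) in
    forall i, (i < n)%N ->
      rarr s' aKey (n + i)%N = if b i <= b p then 0 else crossing sg b p i) s.
Proof.
move=> ld; set p := narr s aStack _.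
have -> : (n * 10 + 6 = (n * 10 + 2).+4)%N by lia.
do 4 exec_step; rewrite (ld_one ld) -/p (ld_sg ld) (ld_b ld).
set s0 := State _ _ _ _; have ld0 : loaded s0 by case: ld.
pose key i := if b i <= b p then 0 else crossing sg b p i.
apply: (@wp_call _ _ _ _ (fun s' =>
  forall i, (0 <= i < n)%N -> rarr s' aKey (n + i)%N = key i)).
- apply: (@wp_for _ _ _ _ _ 8 (fun j s' =>
    forall i, (j <= i < n)%N -> rarr s' aKey (n + i)%N = key i) n) => //.
  + exact: ld_n ld0.
  + exact: ld_one ld0.
  + by move=> i; lia.
  + move=> j s' jn ej fr inv; have ld' : loaded s' by apply: loaded_frame fr ld0.
    have sgE : rvar s' rSgP = sg p by rewrite (frame_rvar fr).
    have bE : rvar s' rBP = b p by rewrite (frame_rvar fr).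
    do 5 exec_step.
    rewrite ej (ld_n ld') (ld_b ld') (ld_sg ld') sgE bE.
    apply: wp_if => /=; rewrite (ld_rzero ld') subr_le0 => h.
      exec_last => i jin; rewrite eqn_add2l (ld_rzero ld').
      by case: eqP => [->|ij]; [rewrite /key h|apply: inv; lia].
    exec_step; exec_last => i jin; rewrite eqn_add2l.
    case: eqP => [->|ij]; last by apply: inv; lia.
    by rewrite /key (negPf h) subr_eq0 gt_eqF // ltNge.
- by [].
by move=> s' _ inv i; apply: inv.
Qed.

Lemma solve_spec s : nvar s iN = n -> nvar s iZero = 0%N -> rvar s rZero = 0 ->
  rvar s rBest = 0 -> rvar s rBeta = beta ->
  rarr s aSg = sg -> rarr s aPb = pb -> rarr s aB = b ->
  wp solve (300 * (n * lg n)) (fun s' =>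
    (exists2 y : R, 0 <= y & rvar s' 0 = dual y) /\
    forall y, 0 <= y -> dual y <= rvar s' 0) s.
Proof.
move=> eN ez erz ebest ebeta esg epb eb; have n0 := n_gt0 wf.
have lg0 : (0 < lg n)%N by [].
apply: (@wp_call _ _ (((n * 5 + 2) + (50 * (n * lg n) + (n * 45 +
  ((lg n * (n * 21 + 20) + 4) + ((n * 10 + 6) + (50 * (n * lg n) +
   ((lg n * (n * 21 + 20) + 4) + 1)))))))).+4 _ (fun s' =>
    (exists2 y : R, 0 <= y & rvar s' 0 = dual y) /\
    forall y, 0 <= y -> dual y <= rvar s' 0)) => //; last first.
  move: (lg n) lg0 => l l0; nia.
do 4 exec_step; rewrite erz sub0r.
set s0 := State _ _ _ _.
have ld0 : loaded s0 by split.
have best0 : rvar s0 rBest = dual 0 by rewrite (dual0 wf).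
clearbody s0.
apply: wp_seq; apply: wp_call (load_b_keys_spec ld0) _ _; first by [].
move=> s1 fr1 key1.
have ld1 : loaded s1 by apply: loaded_frame fr1 ld0.
apply: wp_seq; apply: wp_call (@sort_keys_spec _ _ n n0 (ld_n ld1) (ld_one ld1)
  (ld_two ld1) (ld_removed ld1) _) _ _.
- by move=> i lin; rewrite key1 // (b_ge0 wf).
- by [].
move=> s2 fr2 [ordD sortD onto].
have ld2 : loaded s2 by apply: loaded_frame fr2 ld1.
apply: wp_seq; apply: wp_call (scan_spec ld2 n0 _ _ onto) _ _.
- by move=> k kn; case: (ordD k kn).
- move=> i i' ii' i'n; have lin : (i < n)%N by lia.
  have [oi ei] := ordD i lin; have [oi' ei'] := ordD i' i'n.
  by rewrite -!key1 // -ei -ei'; apply: sortD.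
- by [].
move=> s3 fr3 [/andP[top0 topn] X0 sortX stk env].
have ld3 : loaded s3 by apply: loaded_frame fr3 ld2.
have best3 : rvar s3 rBest = dual 0.
  by rewrite (frame_rvar fr3) // (frame_rvar fr2) // (frame_rvar fr1).
have X_ge0 k : (k < nvar s3 iTop)%N -> 0 <= rarr s3 aX k.
  by move=> kt; rewrite -X0; apply: sortX.
apply: wp_seq; apply: wp_call (@search_spec _ _ _ _ _ _ wf aX iTop _ (lg n) s3 ld3
  erefl _ sortX X_ge0 _) _ _.
- exact: leq_ltn_trans topn (lt_exp_lg n).
- by exists 0.
- by [].
move=> s4 fr4 [_ att4 lo4 below4 above4].
have ld4 : loaded s4 by apply: loaded_frame fr4 ld3.
have stkE : narr s4 aStack = narr s3 aStack by rewrite (frame_narr fr4).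
apply: wp_seq; apply: wp_call (load_crossing_keys_spec ld4) _ _; first by [].
rewrite stkE; set q := (nvar s4 iLo - 1)%N; set p := narr s3 aStack q => s5 fr5 key5.
have qt : (q < nvar s3 iTop)%N by rewrite /q; lia.
have pn : (p < n)%N by apply: stk.
have ld5 : loaded s5 by apply: loaded_frame fr5 ld4.
have key5_ge0 i : (i < n)%N -> 0 <= rarr s5 aKey (n + i)%N.
  move=> lin; rewrite key5 //; case: (leP (b i)) => // bpi.
  rewrite /crossing divr_ge0 ?subr_ge0 ?(ltW bpi) // ltW // addr_gt0 //;
    exact: sg_gt0 wf _ _.
apply: wp_seq; apply: wp_call (@sort_keys_spec _ _ n n0 (ld_n ld5) (ld_one ld5)
  (ld_two ld5) (ld_removed ld5) key5_ge0) _ _; first by [].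
move=> s6 fr6 [ordD6 sortD6 onto6].
have ld6 : loaded s6 by apply: loaded_frame fr6 ld5.
have best6 : rvar s6 rBest = rvar s4 rBest.
  by rewrite (frame_rvar fr6) // (frame_rvar fr5).
apply: wp_seq; apply: wp_call (@search_spec _ _ _ _ _ _ wf aD iN _ (lg n) s6 ld6
  (ld_n ld6) (lt_exp_lg n) sortD6 _ _) _ _.
- by move=> k kn; have [? ->] := ordD6 k kn; apply: key5_ge0.
- by rewrite best6.
- by [].
move=> s7 fr7 [best7 att7 lo7 below7 above7].
exec_last; split=> // y y0; rewrite best6 in best7.
have D_le k : (k < n)%N -> dual (rarr s6 aD k) <= rvar s7 rBest.
  move=> kn; case: (ltnP k (nvar s7 iLo)) => klo; last exact: above7 klo kn (lexx _).
  apply: below7 klo _ (lexx _).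
  by have [? ->] := ordD6 k kn; apply: key5_ge0.
have X_le k : (k < nvar s3 iTop)%N -> dual (rarr s3 aX k) <= rvar s7 rBest.
  move=> kt; apply: le_trans best7; case: (ltnP k (nvar s4 iLo)) => klo.
    exact: below4 klo (X_ge0 _ kt) (lexx _).
  exact: above4 klo kt (lexx _).
(* Rates outside one segment of the envelope were settled by the first search. *)
have [yq|qy] := ltP y (rarr s3 aX q).
  apply: le_trans best7; case: (posnP (nvar s4 iLo)) => lo0.
    by apply: (above4 0%N) => //; rewrite ?lo0 ?X0.
  by apply: (below4 q) => //; [rewrite /q; lia|apply: ltW].
(* What is left is the segment of the envelope that starts at [X q]. *)
pose hi := if (q.+1 < nvar s3 iTop)%N then Some (rarr s3 aX q.+1) else None.
case: (boolP ((q.+1 < nvar s3 iTop)%N && (rarr s3 aX q.+1 <= y))) => [/andP[qt1 qy1]|inside].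
  by apply: le_trans best7; apply: (above4 q.+1) => //; rewrite /q; lia.
apply: (@le_between_crossings _ _ _ _ _ _ wf _ p (rarr s3 aX q) hi) => //.
- exact: X_ge0.
- exact: X_le.
- by rewrite /hi; case: ifP => // qt1; apply: X_le.
- move=> z qz zhi; apply: (envelopeP wf) => //; apply: env => // qt1.
  by move: zhi; rewrite /hi qt1.
- move=> i lin bpi; have [k kn ek] := onto6 i lin.
  have [_ Dk] := ordD6 k kn; have := D_le k kn.
  by rewrite Dk ek key5 // (leNgt (b i)) bpi.
- move: inside; rewrite /hi; case: ifP => //= _; rewrite -ltNge; exact: ltW.
Qed.

End Main.

(** As [2 ^ (lg n - 1) <= n], the number of halvings is at most [2 ln n / ln 2] for
    [n >= 2]. *)
Lemma lg_bigO (R : realType) (c : nat) :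
  (fun n : nat => (c * (n * lg n))%N%:R : R^o) =O_\oo
    (fun n : nat => n%:R * ln n%:R : R^o).
Proof.
have ln2 : 0 < ln 2 :> R by rewrite ln_gt0 // ltr1n.
apply/eqOP; near=> k; near=> n.
have n2 : (2 <= n)%N by near: n; exists 2%N.
have lgn : (lg n)%:R <= 2 / ln 2 * ln n%:R :> R.
  have t1 : (0 < trunc_log 2 n)%N by rewrite trunc_log_gt0.
  have : (trunc_log 2 n)%:R * ln 2 <= ln n%:R :> R.
    rewrite mulr_natl -lnXn // ler_ln ?posrE ?exprn_gt0 ?ltr0n //; last by lia.
    by rewrite -natrX ler_nat trunc_logP //; lia.
  have : (lg n)%:R <= 2 * (trunc_log 2 n)%:R :> R.
    by rewrite -natrM ler_nat /lg; lia.
  move=> h1 h2; apply: le_trans h1 _; rewrite -mulrA ler_wpM2l //.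
  by rewrite mulrC ler_pdivlMr.
rewrite normr_nat !natrM.
have lnn : 0 <= ln n%:R :> R by rewrite ln_ge0 // ler1n; lia.
rewrite ger0_norm ?mulr_ge0 //.
apply: (@le_trans _ _ (c%:R * (2 / ln 2) * (n%:R * ln n%:R))).
  rewrite -mulrA ler_wpM2l // [leRHS]mulrCA ler_wpM2l //.
by rewrite ler_wpM2r ?mulr_ge0.
Unshelve. all: by end_near.
Qed.

Lemma entryE (R : realType) S (v : 'cV[R]_S) (i : 'I_S) : entry v i = v i 0.
Proof. by rewrite /entry valK. Qed.

Lemma valid_wf (R : realType) S (I : instance R S) : valid_instance I ->
  wf_data S (entry (sigma I)) (entry (pbar I)) (entry (bvec I)) (beta I).
Proof.
case=> s0 [p0 p1] b0 _ [_ [[i _ <-] _] bi].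
have ordE (P : R -> Prop) (v : 'cV[R]_S) :
    (forall i, P (v i 0)) -> forall i, (i < S)%N -> P (entry v i).
  by move=> Pv k kS; have := Pv (Ordinal kS); rewrite -entryE.
split.
- by case: (i) => m; case: (S).
- exact: (ordE (fun x => 0 < x)).
- exact: (ordE (fun x => 0 <= x)).
- by rewrite -p1; apply: eq_bigr => k _; rewrite entryE.
- exact: (ordE (fun x => 0 <= x)).
- by exists i => //; rewrite entryE.
Qed.

Lemma deviationE (R : realType) S (I : instance R S) (p : 'cV[R]_S) :
  valid_instance I ->
  deviation I p = \sum_(i < S) entry (sigma I) i * `|p i 0 - entry (pbar I) i|.
Proof.
case=> s0 _ _ _ _; apply: eq_bigr => i _.
rewrite mul_diag_mx !mxE !entryE normrM gtr0_norm //.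
Qed.

Lemma dual_optimal (R : realType) S (I : instance R S) (v : R) :
  let g := dual S (entry (sigma I)) (entry (pbar I)) (entry (bvec I)) (beta I) in
  valid_instance I -> (exists2 y : R, 0 <= y & v = g y) ->
  (forall y, 0 <= y -> g y <= v) -> is_optimal_value I v.
Proof.
move=> g valid [y0 y00 vy0] vmax; have wf := valid_wf valid.
have bE (p : 'cV[R]_S) :
    ((bvec I)^T *m p) 0 0 = \sum_(i < S) entry (bvec I) i * p i 0.
  by rewrite mxE; apply: eq_bigr => i _; rewrite mxE entryE.
have lower p : feasible I p -> v <= deviation I p.
  move=> [pb [p0 p1]]; rewrite vy0 deviationE //.
  by apply: weak_duality => //; rewrite -bE.
have [p [p0 p1 pb pv]] := strong_duality wf vmax.
pose P : 'cV[R]_S := \col_i p i.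
have feasP : feasible I P.
  split; first by rewrite bE; under eq_bigr do rewrite mxE.
  by split=> [i|]; [rewrite mxE|under eq_bigr do rewrite mxE].
split; last by move=> _ [p' feas <-]; apply: lower.
exists P => //; apply/le_anti/andP; split; last exact: lower.
by rewrite deviationE //; under eq_bigr do rewrite mxE.
Qed.

Theorem theorem3 (R : realType) :
  exists (P : prog) (T : nat -> nat),
    computes_optimal_value_in R P T /\
    (fun S : nat => (T S)%:R : R^o) =O_\oo
      (fun S : nat => S%:R * ln S%:R : R^o).
Proof.
exists solve, (fun n => 300 * (n * lg n))%N; split; last exact: lg_bigO.
move=> S I valid.
have [k [s' [e le [att max]]]] := solve_spec (s := init_state I)
  (valid_wf valid) erefl erefl erefl erefl erefl erefl erefl erefl.
by exists k, s'; split=> //; apply: dual_optimal att max.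
Qed.
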